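(* Let $C_{\rm sm}$ be an absolute constant having the compact smoothing property stated in the context. There are absolute thresholds $\bar C\ge2$ and $\bar c>0$ such that, for any fixed absolute constants $C_{\log}\ge\bar C$ and $0<c_{\rm reg}\le\bar c$, the following holds. For every fixed $c\ge1$ there exist constants $C_0,C_1,c_0,n_0>0$ such that for every fixed $0<\beta<1/2$ and any sequence of parameters $(n,L,\mu,R,\varepsilon,T)$ (sequence index suppressed) with $n\to\infty$, $n\ge n_0$, $R>0$, $0<\mu<L$, and, with $$M_0:=\frac{1}{4\sqrt{C_{\rm sm}}}\,\frac{\sqrt{(L-\mu)\,\varepsilon}}{n^{1/4}},$$ satisfying $$M_0\ge C_1\mu R,\qquad 0<\varepsilon<c_0\mu R^2,\qquad \mathfrak A_{4c+8}(M_0,\mu,2\varepsilon,n)\le c_{\rm reg},$$ and $$T=o\left[\left(n^{3/4}\sqrt{\frac{L-\mu}{\mu}}\right)^c\right],$$ one has, for all sufficiently late members of the sequence, $$\Delta_{\mathcal F_{\rm SmSC}^{L,\mu}(B_R)}(\varepsilon,\beta,T)\le C_0\max\left\{\frac{\sqrt\mu\,\varepsilon}{n^{1/4}\sqrt{L-\mu}},\frac{\varepsilon}{n}\right\}\left(13C_1c\log\left(C_1n^{3/4}\sqrt{\frac{L-\mu}{\mu}}\right)\right)^2.$$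
   Context: $B_R=\{x\in\mathbb R^n:\|x\|_2\le R\}$. $\mathcal F_{\rm SmSC}^{L,\mu}(B_R)$ is the class of convex functions $f:B_R\to\mathbb R$ that are $L$-smooth on $B_R$ ($f$ is continuously differentiable on a neighbourhood of $B_R$ and $\nabla f$ is $L$-Lipschitz on $B_R$) and $\mu$-strongly convex, i.e. $f(y)\ge f(x)+\langle s_x,y-x\rangle+\frac\mu2\|y-x\|_2^2$ for $x,y\in B_R$, $s_x\in\partial f(x)$. Compact smoothing property of $C_{\rm sm}$: for every $n$ there is a probability law of a random vector $U$ supported on the closed Euclidean unit ball of $\mathbb R^n$ such that, for all $M,\gamma>0$ and every convex $M$-Lipschitz $g:\mathbb R^n\to\mathbb R$, the function $S_\gamma g(x)=\mathbb E[g(x+\gamma U)]$ is convex and $C^1$, $|S_\gamma g(x)-g(x)|\le M\gamma$, and $\|\nabla S_\gamma g(x)-\nabla S_\gamma g(y)\|_2\le C_{\rm sm}\frac{\sqrt n\,M}{\gamma}\|x-y\|_2$ for all $x,y$. Noisy oracle: for $f:S\to\mathbb R$, $S\subset\mathbb R^n$, $\delta\ge0$, let $\mathsf O_\delta(f)=\{O:S\to\mathbb R:\ \sup_{x\in S}|O(x)-f(x)|\le\delta\}$. Solvability: algorithms query points of $S$ and output a point of $S$. A randomized adaptive algorithm $A$ making at most $T$ oracle calls $(\varepsilon,\beta,\delta,T)$-solves a class $\mathcal F$ of functions on $S$ if for every $f\in\mathcal F$ and every deterministic oracle $O\in\mathsf O_\delta(f)$ its output $A^O$ satisfies $\mathbb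 P_A\{f(A^O)-\inf_S f\le\varepsilon\}\ge1-\beta$, the probability being over the internal randomness of $A$ (deterministic adaptive algorithms are included). The maximum admissible level of noise is $\Delta_{\mathcal F}(\varepsilon,\beta,T)=\sup\{\delta:\ \text{there is }A\text{ that }(\varepsilon,\beta,\delta,T)\text{-solves }\mathcal F\}$. For $c\ge1$, $$\mathfrak A_c(M,\mu,\varepsilon,n)=\left(13c\log\frac{C_{\log}nM}{\sqrt{\mu\varepsilon}}\right)^2\max\left\{\frac{\sqrt{\mu\varepsilon}}{\sqrt n\,M},\frac1n\right\}.$$ Convention: $T=o(Q)$ means $T/Q\to0$ along the sequence of parameters. All constants are independent of the particular sequence. *)

(* Defs.v *)
(* MathComp-Analysis, over an arbitrary realType. *)
From HB Require Import structures.
From mathcomp Require Import all_boot all_order all_algebra.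
From mathcomp Require Import all_classical all_reals all_analysis.
Set Implicit Arguments.
Unset Strict Implicit.
Unset Printing Implicit Defensive.
Import Order.TTheory GRing.Theory Num.Theory.
Import numFieldNormedType.Exports.
Local Open Scope classical_set_scope.
Local Open Scope ring_scope.

(* The library norm on 'rV[R]_n is the sup norm: it gives the right topology
   and notion of differentiability, but Lipschitz bounds and balls below refer
   to the Euclidean norm. *)
Definition dotv (R : realType) (n : nat) (u v : 'rV[R]_n) : R :=
  \sum_(i < n) u 0 i * v 0 i.

Definition norm2 (R : realType) (n : nat) (u : 'rV[R]_n) : R :=
  Num.sqrt (dotv u u).

Definition ball2 (R : realType) (n : nat) (r : R) : set 'rV[R]_n :=
  [set x | norm2 x <= r].

Definition borelRn (R : realType) (n : nat) :=
  g_sigma_algebraType (@open 'rV[R]_n).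

Definition grad (R : realType) (n : nat) (f : 'rV[R]_n -> R) (x : 'rV[R]_n) :
    'rV[R]_n :=
  \row_(i < n) 'D_(delta_mx 0 i) f x.

Definition C1_on (R : realType) (n : nat) (U : set 'rV[R]_n)
    (f : 'rV[R]_n -> R) : Prop :=
  (forall x, U x -> differentiable f x) /\ {within U, continuous (grad f)}.

Definition lipschitz_fun (R : realType) (n : nat) (M : R)
    (g : 'rV[R]_n -> R) : Prop :=
  forall x y, `|g x - g y| <= M * norm2 (x - y).

Definition lipschitz_map_on (R : realType) (n : nat) (S : set 'rV[R]_n) (K : R)
    (G : 'rV[R]_n -> 'rV[R]_n) : Prop :=
  forall x y, S x -> S y -> norm2 (G x - G y) <= K * norm2 (x - y).

(* Functions f : S -> R are represented by total functions whose values outside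
   S are irrelevant; the predicates below depend only on f restricted to S. *)

Definition subdifferential (R : realType) (n : nat) (S : set 'rV[R]_n)
    (f : 'rV[R]_n -> R) (x : 'rV[R]_n) : set 'rV[R]_n :=
  [set s | forall y, S y -> f x + dotv s (y - x) <= f y].

Definition strongly_convex_on (R : realType) (n : nat) (S : set 'rV[R]_n)
    (mu : R) (f : 'rV[R]_n -> R) : Prop :=
  forall x y s, S x -> S y -> subdifferential S f x s ->
    f x + dotv s (y - x) + mu / 2 * norm2 (y - x) ^+ 2 <= f y.

Definition smooth_on (R : realType) (n : nat) (S : set 'rV[R]_n) (L : R)
    (f : 'rV[R]_n -> R) : Prop :=
  exists (U : set 'rV[R]_n) (F : 'rV[R]_n -> R),
    [/\ open U, S `<=` U, {in S, F =1 f}, C1_on U F &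
        lipschitz_map_on S L (grad F)].

Definition SmSC (R : realType) (n : nat) (L mu r : R) :
    set ('rV[R]_n -> R) :=
  [set f | [/\ convex_function (ball2 r) f, smooth_on (ball2 r) L f &
               strongly_convex_on (ball2 r) mu f]].

Definition smoothing (R : realType) (n : nat) (U : probability (borelRn R n) R)
    (gamma : R) (g : 'rV[R]_n -> R) (x : 'rV[R]_n) : R :=
  fine ('E_U[fun u : borelRn R n => (g (x + gamma *: (u : 'rV[R]_n)))%R])%E.

Definition compact_smoothing (R : realType) (Csm : R) : Prop :=
  forall n : nat, (0 < n)%N ->
  exists U : probability (borelRn R n) R,
    U (@ball2 R n 1) = 1%E /\
    forall (M gamma : R) (g : 'rV[R]_n -> R), 0 < M -> 0 < gamma ->
      convex_function setT g -> lipschitz_fun M g ->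
      [/\ convex_function setT (smoothing U gamma g),
          C1_on setT (smoothing U gamma g),
          forall x, `|smoothing U gamma g x - g x| <= M * gamma &
          lipschitz_map_on setT (Csm * (Num.sqrt n%:R * M / gamma))
            (grad (smoothing U gamma g))].

Definition noisy_oracle (R : realType) (n : nat) (S : set 'rV[R]_n) (delta : R)
    (f : 'rV[R]_n -> R) : set ('rV[R]_n -> R) :=
  [set O | (ereal_sup [set `|O x - f x|%:E | x in S] <= delta%:E)%E].

(* A deterministic adaptive algorithm is a decision tree: it either stops with
   an output or queries a point and continues according to the answer. *)
Inductive algo (R X : Type) : Type :=
| Output of X
| Query of X & (R -> algo R X).

Fixpoint output (R X : Type) (O : X -> R) (t : algo R X) : X :=
  match t with
  | Output x => x
  | Query x k => output O (k (O x))
  end.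

Fixpoint queries (R X : Type) (O : X -> R) (t : algo R X) : seq X :=
  match t with
  | Output _ => [::]
  | Query x k => x :: queries O (k (O x))
  end.

Definition admissible (R : Type) (X : eqType) (S : set X) (T : nat)
    (t : algo R X) : Prop :=
  forall O : X -> R,
    [/\ (size (queries O t) <= T)%N,
        forall x, x \in queries O t -> S x & S (output O t)].

(* The internal randomness is a point w of a probability space; deterministic
   algorithms are the case of a one-point space. *)
Record rand_algo (R : realType) (X : Type) := RandAlgo {
  ra_disp : measure_display;
  ra_space : measurableType ra_disp;
  ra_prob : probability ra_space R;
  ra_algo : ra_space -> algo R X }.

(* On the classes considered here f is bounded below on S, so that the
   real-valued infimum is the genuine one. *)
Definition success (R : realType) (n : nat) (S : set 'rV[R]_n) (eps : R)
    (f O : 'rV[R]_n -> R) (A : rand_algo R 'rV[R]_n) : set (ra_space A) :=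
  [set w | f (output O (ra_algo w)) - inf (f @` S) <= eps].
Arguments success {R n} S eps f O A.

(* O ranges over all functions, including non-measurable ones, for which no
   reasonable algorithm can guarantee that success is an event.  Success is
   required to be an event whenever O is Borel, and its probability is
   required to be at least 1 - beta whenever it is an event. *)
Definition solves (R : realType) (n : nat) (S : set 'rV[R]_n)
    (F : set ('rV[R]_n -> R)) (eps beta delta : R) (T : nat)
    (A : rand_algo R 'rV[R]_n) : Prop :=
  (forall w, admissible S T (@ra_algo R _ A w)) /\
  forall f O, F f -> noisy_oracle S delta f O ->
    (measurable_fun (S : set (borelRn R n)) (O : borelRn R n -> R) ->
      measurable (success S eps f O A)) /\
    (measurable (success S eps f O A) ->
      ((1 - beta)%:E <= ra_prob A (success S eps f O A))%E).

(* The supremum is taken in the extended reals (-oo if no level is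
   admissible). *)
Definition max_noise (R : realType) (n : nat) (S : set 'rV[R]_n)
    (F : set ('rV[R]_n -> R)) (eps beta : R) (T : nat) : \bar R :=
  ereal_sup [set delta%:E | delta in
    [set delta : R | 0 <= delta /\
       exists A : rand_algo R 'rV[R]_n, solves S F eps beta delta T A]].

Definition regA (R : realType) (Clog c M mu eps : R) (n : nat) : R :=
  (13 * c * ln (Clog * n%:R * M / Num.sqrt (mu * eps))) ^+ 2 *
  Num.max (Num.sqrt (mu * eps) / (Num.sqrt n%:R * M)) (n%:R^-1).

Definition M0 (R : realType) (Csm L mu eps : R) (n : nat) : R :=
  1 / (4 * Num.sqrt Csm) *
  (Num.sqrt ((L - mu) * eps) / n%:R `^ (1 / 4)).

(* Main.v *)
From HB Require Import structures.
Require Import Defs.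
From mathcomp Require Import all_boot all_order all_algebra.
From mathcomp Require Import all_classical all_reals all_analysis.
From mathcomp Require Import measurable_realfun.
From mathcomp Require Import ring lra.
Import Order.TTheory GRing.Theory Num.Theory.
Import numFieldNormedType.Exports.
Local Open Scope classical_set_scope.
Local Open Scope ring_scope.

(* Put rho = sqrt (eps / mu), D = sqrt ((L - mu) / mu).  The hard functions are
     f_v x = mu / 2 |x|^2 + eps h_v (x / rho),
   where h_v smooths max (N |x| - 4, - 3 <v, x>) and v is a random sign vector
   of norm 1.  The cone |x| is replaced by the support function of the slab
   {|z| <= 1, |<z, v>| <= tau}, regularized by a quadratic: it agrees with a
   function independent of v as soon as |<v, x>| <= tau |x|, and it costs only
   N tau <= 1 at x = v, where f_v falls well below its values at the points
   weakly correlated with v.  At these points f_v differs by O(eps tau / N) from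
   a function not depending on v, which an oracle with that much noise may
   return instead.  A fixed point is correlated with v with probability at most
   2 exp (- n tau^2 / 8), so with tau^2 = 8 c ln (C1 n^(3/4) D) / n, an
   algorithm making o((n^(3/4) D)^c) queries fails for most v.  Taking
   N = min (D / 3, 1 / tau) makes the gradient of f_v L-Lipschitz and
   tau / N = max (3 tau / D, tau^2). *)

(** * Euclidean geometry of row vectors *)

Section Euclidean.
Context {R : realType} {n : nat}.
Implicit Types (u v w : 'rV[R]_n) (a : R).

Lemma dotvC u v : dotv u v = dotv v u.
Proof. by apply: eq_bigr => i _; rewrite mulrC. Qed.

Lemma dotv_is_linear u : linear (dotv u : 'rV[R]_n -> R^o).
Proof.
move=> a v w; rewrite /dotv scaler_sumr -big_split /=.
by apply: eq_bigr => i _; rewrite !mxE mulrDr mulrCA.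
Qed.

HB.instance Definition _ u :=
  GRing.isLinear.Build R 'rV[R]_n R^o *:%R (dotv u) (dotv_is_linear u).

Lemma dotvDr u v w : dotv u (v + w) = dotv u v + dotv u w.
Proof. exact: linearD. Qed.

Lemma dotvBr u v w : dotv u (v - w) = dotv u v - dotv u w.
Proof. exact: linearB. Qed.

Lemma dotvZr u a v : dotv u (a *: v) = a * dotv u v.
Proof. exact: linearZ. Qed.

Lemma dotv0 u : dotv u 0 = 0.
Proof. exact: linear0. Qed.

Lemma dotvDl u v w : dotv (v + w) u = dotv v u + dotv w u.
Proof. by rewrite dotvC dotvDr !(dotvC u). Qed.

Lemma dotvBl u v w : dotv (v - w) u = dotv v u - dotv w u.
Proof. by rewrite dotvC dotvBr !(dotvC u). Qed.

Lemma dotvZl u a v : dotv (a *: v) u = a * dotv v u.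
Proof. by rewrite dotvC dotvZr dotvC. Qed.

Lemma dotvNr u v : dotv u (- v) = - dotv u v.
Proof. exact: linearN. Qed.

Lemma dotvNl u v : dotv (- v) u = - dotv v u.
Proof. by rewrite dotvC dotvNr dotvC. Qed.

Lemma dotv_delta u i : dotv u (delta_mx 0 i) = u 0 i.
Proof.
rewrite /dotv (bigD1 i) //= big1 => [|j ji]; rewrite mxE ?eqxx ?mulr1 ?addr0 //.
by rewrite (negbTE ji) mulr0.
Qed.

Lemma dotv_ge0 u : 0 <= dotv u u.
Proof. by apply: sumr_ge0 => i _; rewrite -expr2 sqr_ge0. Qed.

Lemma norm2_ge0 u : 0 <= norm2 u.
Proof. exact: sqrtr_ge0. Qed.
Hint Resolve norm2_ge0 : core.

Lemma norm2_sqr u : norm2 u ^+ 2 = dotv u u.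
Proof. by rewrite sqr_sqrtr // dotv_ge0. Qed.

Lemma norm2_eq0 u : norm2 u = 0 -> u = 0.
Proof.
move=> u0; have : dotv u u = 0 by rewrite -norm2_sqr u0 expr0n.
move=> /psumr_eq0P => u2; apply/rowP => i; rewrite mxE.
have /eqP : u 0 i * u 0 i = 0.
  by apply: u2 => // j _; rewrite -expr2 sqr_ge0.
by rewrite -expr2 sqrf_eq0 => /eqP.
Qed.

Lemma norm20 : norm2 (0 : 'rV[R]_n) = 0.
Proof. by rewrite /norm2 dotv0 sqrtr0. Qed.

Lemma norm2Z a u : norm2 (a *: u) = `|a| * norm2 u.
Proof.
by rewrite /norm2 dotvZr dotvZl mulrA -expr2 sqrtrM ?sqr_ge0 // sqrtr_sqr.
Qed.

Lemma norm2N u : norm2 (- u) = norm2 u.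
Proof. by rewrite -scaleN1r norm2Z normrN normr1 mul1r. Qed.

Lemma dotv_le u v : dotv u v <= norm2 u * norm2 v.
Proof.
have [u0|u0] := eqVneq (norm2 u) 0.
  by rewrite u0 (norm2_eq0 u u0) dotvC dotv0 mul0r.
have [v0|v0] := eqVneq (norm2 v) 0.
  by rewrite v0 (norm2_eq0 v v0) dotv0 mulr0.
have a0 : 0 < norm2 u by rewrite lt_def u0 norm2_ge0.
have b0 : 0 < norm2 v by rewrite lt_def v0 norm2_ge0.
(* With p, q the norms and s the product, this square expands to 2 p q (p q - s). *)
have := dotv_ge0 (norm2 v *: u - norm2 u *: v).
rewrite dotvBr !dotvBl !dotvZl !dotvZr -!norm2_sqr (dotvC v u).
move: a0 b0; move: (norm2 u) (norm2 v) (dotv u v) => p q s p0 q0 h.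
have pq0 : 0 < p * q by exact: mulr_gt0.
have : 0 <= (2 * (p * q)) * (p * q - s) by nra.
by rewrite pmulr_rge0 ?subr_ge0 // mulr_gt0.
Qed.

Lemma normr_dotv_le u v : `|dotv u v| <= norm2 u * norm2 v.
Proof.
by rewrite ler_norml dotv_le andbT lerNl -dotvNr -(norm2N v) dotv_le.
Qed.

Lemma norm2D u v : norm2 (u + v) <= norm2 u + norm2 v.
Proof.
rewrite -(@ler_pXn2r _ 2) ?nnegrE ?addr_ge0 //.
rewrite norm2_sqr dotvDr !dotvDl -!norm2_sqr (dotvC v u).
have := dotv_le u v; nra.
Qed.

Lemma norm2B u v : norm2 (u - v) = norm2 (v - u).
Proof. by rewrite -opprB norm2N. Qed.

Lemma norm2_le_mx_norm u : norm2 u <= Num.sqrt n%:R * `|u|.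
Proof.
rewrite -(@ler_pXn2r _ 2) ?nnegrE ?mulr_ge0 ?sqrtr_ge0 //.
rewrite norm2_sqr exprMn sqr_sqrtr //.
have -> : n%:R * `|u| ^+ 2 = \sum_(i < n) `|u| ^+ 2.
  by rewrite sumr_const card_ord mulr_natl.
apply: ler_sum => i _; rewrite -expr2 -[u 0 i ^+ 2]real_normK ?num_real //.
by rewrite ler_pXn2r ?nnegrE // [leRHS]/Num.norm /= mx_normrE;
  apply: (le_bigmax _ (fun ij => `|u ij.1 ij.2|) (0, i)).
Qed.

Lemma lipschitz_continuous (W : normedModType R) K (f : 'rV[R]_n -> W) :
  (forall x y, `|f x - f y| <= K * norm2 (x - y)) -> continuous f.
Proof.
move=> fK x; apply/(cvgrPdist_le (FF := nbhs_filter x)) => e e0.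
pose C := `|K| * Num.sqrt n%:R + 1.
have C0 : 0 < C by rewrite ltr_wpDl // mulr_ge0 // sqrtr_ge0.
near=> y; apply: (le_trans (fK _ _)).
apply: (@le_trans _ _ (C * `|x - y|)).
  have := norm2_le_mx_norm (x - y); have := norm2_ge0 (x - y).
  have := ler_norm K; have := normr_ge0 K; have := normr_ge0 (x - y).
  have := sqrtr_ge0 (n%:R : R); rewrite /C.
  move: (norm2 _) (`|K|) (`|x - y|) (Num.sqrt _) => a b c d d0 c0 b0 Kb a0 adc.
  have : b * a <= b * (d * c) by rewrite ler_wpM2l.
  nra.
rewrite mulrC -ler_pdivlMr //; near: y.
by apply: cvgr_dist_le; [exact: cvg_id | exact: divr_gt0].
Unshelve. all: by end_near. Qed.

Lemma continuous_dotv u : continuous (dotv u).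
Proof.
apply: (@lipschitz_continuous _ (norm2 u)) => x y.
by rewrite -dotvBr normr_dotv_le.
Qed.

Lemma ler_dist_norm2 u v : `|norm2 u - norm2 v| <= norm2 (u - v).
Proof.
have := norm2D (u - v) v; have := norm2D (v - u) u.
by rewrite !subrK (norm2B v u) ler_distl => h1 h2; apply/andP; split; lra.
Qed.

Lemma continuous_norm2 : continuous (@norm2 R n).
Proof.
apply: (@lipschitz_continuous _ 1) => x y.
by rewrite mul1r ler_dist_norm2.
Qed.

Lemma continuous_dotvv : continuous (fun u => dotv u u).
Proof.
rewrite (_ : (fun u => dotv u u) = (fun u => norm2 u * norm2 u)); last first.
  by apply/funext => u; rewrite -norm2_sqr expr2.
by move=> x; apply: continuousM; move: x; exact: continuous_norm2.
Qed.

Lemma mx_norm_le_norm2 u : `|u| <= norm2 u.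
Proof.
rewrite [leLHS]/Num.norm /= mx_normrE; apply/bigmax_leP;
  split=> //= -[k i] _ /=.
by rewrite ord1 -dotv_delta (le_trans (normr_dotv_le _ _)) //
  /norm2 dotv_delta mxE !eqxx sqrtr1 mulr1.
Qed.

End Euclidean.
#[local] Hint Extern 0 (is_true (0 <= norm2 _)) => solve [apply: norm2_ge0] :
  core.

(** * Lipschitz selections of subgradients *)

(** A global choice of subgradients with quadratic gain [mu]; [mu = 0] gives a plain subgradient
    field. Convexity, strong convexity and, once [p] is Lipschitz, smoothness with gradient [p] are
    all derived from it. *)
Definition subgradient_selection {R : realType} {n : nat} (mu : R)
    (f : 'rV[R]_n -> R) (p : 'rV[R]_n -> 'rV[R]_n) : Prop :=
  forall x y, f x + dotv (p x) (y - x) + mu / 2 * norm2 (y - x) ^+ 2 <= f y.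

Section SubgradientSelection.
Context {R : realType} {n : nat} {mu L : R}.
Context {f : 'rV[R]_n -> R} {p : 'rV[R]_n -> 'rV[R]_n}.
Hypothesis mu0 : 0 <= mu.
Hypothesis fp : subgradient_selection mu f p.

Lemma selection_taylor x y : f x + dotv (p x) (y - x) <= f y.
Proof.
apply: le_trans (fp x y); rewrite lerDl.
by rewrite mulr_ge0 ?exprn_ge0 ?divr_ge0.
Qed.

Lemma selection_lipschitz B : (forall x, norm2 (p x) <= B) ->
  forall x y, `|f x - f y| <= B * norm2 (x - y).
Proof.
move=> pB x y.
have b z := le_trans (normr_dotv_le (p z) (y - x)) (ler_wpM2r (norm2_ge0 _) (pB
  z)).
have := b x; have := b y; rewrite !ler_norml (norm2B x) => /andP[b1 b2]
  /andP[b3 b4].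
have h1 := selection_taylor x y; have h2 := selection_taylor y x.
move: h2; rewrite -(opprB y x) dotvNr => h2.
by apply/andP; split; lra.
Qed.

(** Weighting the inequalities from z towards x and y by 1 - t and t cancels the linear terms, and
    the quadratic gains add up to the factor t (1 - t). *)
Lemma selection_jensen x y t : 0 <= t -> t <= 1 ->
  f (x + t *: (y - x)) <=
  (1 - t) * f x + t * f y - mu / 2 * (t * (1 - t)) * norm2 (y - x) ^+ 2.
Proof.
move=> t0 t1; set z := x + t *: (y - x).
have zx : x - z = (- t) *: (y - x).
  by rewrite /z opprD addrA subrr add0r scaleNr.
have zy : y - z = (1 - t) *: (y - x).
  by rewrite /z opprD addrA scalerBl scale1r.
have := fp z x; have := fp z y; rewrite zx zy !dotvZr !norm2Z !exprMn.
rewrite !real_normK ?num_real //.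
move: (f z) (f x) (f y) (dotv _ _) (norm2 _ ^+ 2) => a b c d e h1 h2.
have := ler_wpM2l t0 h1; have : 0 <= 1 - t by rewrite subr_ge0.
move=> /ler_wpM2l/(_ _ _ h2); lra.
Qed.

Lemma selection_convex (S : set 'rV[R]_n) : convex_function S f.
Proof.
move=> t x y _ _; rewrite convRE.
have t0 : 0 <= t%:num by exact: ge0.
have t1 : t%:num <= 1 by exact: le1.
move: t0 t1; set t' := t%:num => t0 t1.
have := selection_jensen y x t' t0 t1.
have -> : y + t' *: (x - y) = t' *: x + (1 - t') *: y.
  by apply/rowP => i; rewrite !mxE; ring.
have : 0 <= mu / 2 * (t' * (1 - t')) * norm2 (x - y) ^+ 2.
  by rewrite !mulr_ge0 ?exprn_ge0 //; lra.
by move=> h /le_trans -> //; rewrite [leRHS]addrC lerBlDr lerDl.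
Qed.

(* A subgradient of the restriction of [f] to [S] need not be a gradient of [f]
   when its base point lies on the boundary, so the quadratic gain is recovered
   by comparing with Jensen along [y - x] as the step tends to 0. *)
Lemma selection_strongly_convex_on (S : set 'rV[R]_n) :
  (forall x y t, S x -> S y -> 0 <= t -> t <= 1 -> S (x + t *: (y - x))) ->
  strongly_convex_on S mu f.
Proof.
move=> Sconv x y s Sx Sy sx; set B := mu / 2 * norm2 (y - x) ^+ 2.
have B0 : 0 <= B by rewrite !mulr_ge0 ?exprn_ge0.
have key t : 0 < t -> t <= 1 -> dotv s (y - x) + B - (f y - f x) <= t * B.
  move=> t0 t1; have t0' := ltW t0.
  have := sx _ (Sconv _ _ _ Sx Sy t0' t1).
  rewrite addrAC subrr add0r dotvZr => h1.
  have := le_trans h1 (selection_jensen x y t t0' t1).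
  rewrite (_ : mu / 2 * (t * (1 - t)) * _ = t * ((1 - t) * B)); last first.
    by rewrite /B; lra.
  move=> h; have : t * (dotv s (y - x) + B - (f y - f x)) <= t * (t * B) by lra.
  by rewrite ler_pM2l.
rewrite leNgt; apply/negP => h; set g := dotv s (y - x) + B - (f y - f x).
have g0 : 0 < g by rewrite /g; lra.
have Bg0 : 0 < B + g by rewrite ltr_wpDl.
have t1 : g / (B + g) <= 1 by rewrite ler_pdivrMr // mul1r lerDr.
have := key _ (divr_gt0 g0 Bg0) t1.
by rewrite -/g mulrAC ler_pdivlMr //; nra.
Qed.

Hypothesis pL : lipschitz_map_on setT L p.

(** The two subgradient inequalities place the remainder between 0 and <p y - p x, y - x>. The sharp
    constant L / 2 is not sought: any quadratic bound yields differentiability. *)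
Lemma selection_remainder x y :
  `|f y - f x - dotv (p x) (y - x)| <= L * norm2 (y - x) ^+ 2.
Proof.
have h1 := selection_taylor x y; have h2 := selection_taylor y x.
rewrite ger0_norm; last by lra.
have h3 : dotv (p y - p x) (y - x) <= L * norm2 (y - x) ^+ 2.
  apply: le_trans (dotv_le _ _) _; rewrite expr2 mulrA.
  by rewrite ler_wpM2r // pL.
move: h2 h3; rewrite dotvBl -(opprB y x) dotvNr; lra.
Qed.

Lemma selection_differentiable x : differentiable f x /\ grad f x = p x.
Proof.
have df : f \o shift x = cst (f x) + dotv (p x) +o_ 0 id.
  (* The factor n compares the squared Euclidean and sup norms; adding 1 keeps [C] positive. *)
  apply/eqaddoP => e e0; pose C := `|L| * n%:R + 1.
  have C0 : 0 < C by rewrite ltr_wpDl // mulr_ge0.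
  near=> h; rewrite /= !fctE /=.
  have := selection_remainder x (h + x); rewrite addrK opprD addrA => /le_trans.
  apply; apply: (@le_trans _ _ (C * `|h| ^+ 2)).
    have n2 : norm2 h ^+ 2 <= n%:R * `|h| ^+ 2.
      have := norm2_le_mx_norm h.
      rewrite -(@ler_pXn2r _ 2) ?nnegrE ?mulr_ge0 ?sqrtr_ge0 //.
      by rewrite !norm2_sqr exprMn sqr_sqrtr.
    apply: (@le_trans _ _ (`|L| * (n%:R * `|h| ^+ 2))).
      apply: (@le_trans _ _ (`|L| * norm2 h ^+ 2)).
        by rewrite ler_wpM2r ?exprn_ge0 // ler_norm.
      by rewrite ler_wpM2l.
    by rewrite mulrA ler_wpM2r ?exprn_ge0 // /C lerDl.
  rewrite expr2 mulrA ler_wpM2r // mulrC -ler_pdivlMr //.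
  near: h; apply/nbhs_ballP; exists (e / C); first exact: divr_gt0.
  by move=> h; rewrite -ball_normE /ball_ /= sub0r normrN => /ltW.
have pc : continuous (dotv (p x) : 'rV[R]_n -> R^o) by exact: continuous_dotv.
have dE : 'd f x = dotv (p x) :> (_ -> _) by exact: diff_unique.
have diff_f : differentiable f x.
  by apply/diff_locallyP; rewrite dE; split.
split=> //; apply/rowP => i; rewrite mxE deriveE // dE dotv_delta //.
Unshelve. all: by end_near. Qed.

Lemma selection_smooth_on (S : set 'rV[R]_n) : smooth_on S L f.
Proof.
have gp : grad f = p by apply/funext => x;
  have [] := selection_differentiable x.
exists setT, f; split=> //; first exact: openT.
  split=> [x _|]; first by have [] := selection_differentiable x.
  apply: continuous_subspaceT; rewrite gp.
  apply: (@lipschitz_continuous _ _ _ L) => x y.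
  exact: le_trans (mx_norm_le_norm2 _) (pL x y I I).
by rewrite gp => x y _ _; exact: pL.
Qed.

Lemma selection_continuous : continuous f.
Proof.
move=> x; apply: (@differentiable_continuous _ _ _ x f).
by have [] := selection_differentiable x.
Qed.

End SubgradientSelection.

Lemma ball2_convex {R : realType} {n : nat} (r : R) (x y : 'rV[R]_n) t :
  ball2 r x -> ball2 r y -> 0 <= t -> t <= 1 -> ball2 r (x + t *: (y - x)).
Proof.
rewrite /ball2 /= => hx hy t0 t1.
rewrite (_ : x + _ = (1 - t) *: x + t *: y); last first.
  by apply/rowP => i; rewrite !mxE; ring.
apply: le_trans (norm2D _ _) _; rewrite !norm2Z !ger0_norm //; last by lra.
nra.
Qed.

Lemma selection_SmSC {R : realType} {n : nat} (L mu r : R) f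
    (p : 'rV[R]_n -> 'rV[R]_n) : 0 <= mu ->
  subgradient_selection mu f p -> lipschitz_map_on setT L p -> SmSC L mu r f.
Proof.
move=> mu0 fp pL; split; first exact: (selection_convex mu0 fp).
- exact: (selection_smooth_on mu0 fp pL).
- by apply: (selection_strongly_convex_on mu0 fp) => x y t; exact: ball2_convex.
Qed.

(** * Regularized support functions *)

Section RegularizedSupport.
Context {R : realType} {n : nat}.
Implicit Types (K : set 'rV[R]_n) (gamma tau : R) (x y z w v : 'rV[R]_n).

(** Its maximum over a compact convex [K] is Nesterov's smoothing of the support function of [K];
    the maximizer is the projection of x / gamma onto [K] and serves as the gradient. *)
Definition penalized gamma x z : R := dotv z x - gamma / 2 * dotv z z.

Definition is_support_point K gamma x : set 'rV[R]_n :=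
  [set z | K z /\ forall w, K w -> penalized gamma x w <= penalized gamma x z].

Definition support_point K gamma x : 'rV[R]_n :=
  xget 0 (is_support_point K gamma x).

Definition reg_support K gamma x : R :=
  penalized gamma x (support_point K gamma x).

Lemma continuous_penalized gamma x : continuous (penalized gamma x).
Proof.
have c1 : continuous (fun z : 'rV[R]_n => dotv z x).
  by under eq_fun do rewrite dotvC; exact: continuous_dotv.
have c2 := @continuous_dotvv R n.
move=> z; apply: (cvgB (FF := nbhs_filter z)); first exact: c1.
by apply: (cvgM (FF := nbhs_filter z)); [exact: cvg_cst | exact: c2].
Qed.

Lemma reg_supportE K gamma x z : is_support_point K gamma x z ->
  reg_support K gamma x = penalized gamma x z.
Proof.
move=> zK; have [pK ple] : is_support_point K gamma x (support_point K gamma x).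
  by apply: (xgetPex 0); exists z.
have [Kz zle] := zK.
by apply/eqP; rewrite eq_le ple // zle.
Qed.

Section Compact.
Context {K : set 'rV[R]_n} {gamma : R}.
Hypothesis gamma0 : 0 < gamma.
Hypothesis K0 : K !=set0.
Hypothesis Kc : compact K.
Hypothesis Kconv : forall x y t, K x -> K y -> 0 <= t -> t <= 1 ->
  K (x + t *: (y - x)).

Lemma support_pointP x : is_support_point K gamma x (support_point K gamma x).
Proof.
apply: (xgetPex 0).
have [|z zK zle] := @EVT_max_rV R n (penalized gamma x) K K0 Kc.
  by apply: continuous_subspaceT; exact: continuous_penalized.
exists z; split=> [|w Kw]; first by rewrite inE in zK.
by apply: zle; rewrite inE.
Qed.

Lemma support_point_mem x : K (support_point K gamma x).
Proof. by have [] := support_pointP x. Qed.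

Lemma penalized_le_reg_support x z :
  K z -> penalized gamma x z <= reg_support K gamma x.
Proof. by have [_] := support_pointP x; apply. Qed.

(** A maximum of functions affine in x: the maximizer at x is still a competitor at y. *)
Lemma reg_support_selection :
  subgradient_selection 0 (reg_support K gamma) (support_point K gamma).
Proof.
move=> x y; rewrite mul0r mul0r addr0.
apply: le_trans (penalized_le_reg_support y _ (support_point_mem x)).
by rewrite /reg_support /penalized dotvBr; lra.
Qed.

(** First-order optimality of p, the angle criterion for projections, from comparing p with p + t (z
    - p) for small t. *)
Lemma support_point_variational x z : K z ->
  dotv (z - support_point K gamma x) (x - gamma *: support_point K gamma x) <=
    0.
Proof.
set p := support_point K gamma x => Kz;
  set B := gamma / 2 * dotv (z - p) (z - p).
have B0 : 0 <= B by rewrite !mulr_ge0 ?dotv_ge0 // ltW.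
have key t : 0 < t -> t <= 1 -> dotv (z - p) (x - gamma *: p) <= t * B.
  move=> t0 t1; have t0' := ltW t0.
  have := penalized_le_reg_support x _
    (Kconv _ _ _ (support_point_mem x) Kz t0' t1).
  rewrite -/p /reg_support -/p /penalized.
  rewrite !(dotvDl, dotvDr, dotvNl, dotvNr, dotvZl, dotvZr) => h.
  rewrite -(ler_pM2l t0); move: h.
  rewrite /B !(dotvDl, dotvDr, dotvNl, dotvNr, dotvZl, dotvZr) !(dotvC p z).
  lra.
rewrite leNgt; apply/negP; set g := dotv _ _ => g0.
have Bg0 : 0 < B + g by rewrite ltr_wpDl.
(* For t = g / (B + g), [key] reads g <= g B / (B + g), impossible when g > 0. *)
have t1 : g / (B + g) <= 1 by rewrite ler_pdivrMr // mul1r lerDr.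
have := key _ (divr_gt0 g0 Bg0) t1.
by rewrite -/g mulrAC ler_pdivlMr //; nra.
Qed.

(** Adding the variational inequalities at x and y gives gamma |p - q|^2 <= <p - q, x - y>, as for
    any projection. *)
Lemma support_point_lipschitz :
  lipschitz_map_on setT gamma^-1 (support_point K gamma).
Proof.
move=> x y _ _; set p := support_point K gamma x;
  set q := support_point K gamma y.
have h1 := support_point_variational x q (support_point_mem y).
have h2 := support_point_variational y p (support_point_mem x).
rewrite -/p -/q in h1 h2.
have h : gamma * norm2 (p - q) ^+ 2 <= norm2 (p - q) * norm2 (x - y).
  apply: le_trans (dotv_le _ _); rewrite norm2_sqr.
  move: h1 h2; rewrite !(dotvDl, dotvDr, dotvNl, dotvNr, dotvZl, dotvZr) (dotvC
    q p); lra.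
rewrite mulrC ler_pdivlMr // mulrC.
have [->|pq0] := eqVneq (norm2 (p - q)) 0; first by rewrite mulr0.
have n0 : 0 < norm2 (p - q) by rewrite lt_def pq0 norm2_ge0.
by rewrite -(ler_pM2l n0) mulrCA -expr2.
Qed.

End Compact.

Definition ball_slab tau v : set 'rV[R]_n :=
  [set z | norm2 z <= 1 /\ `|dotv z v| <= tau].

Lemma closed_sublevel (f : 'rV[R]_n -> R) (r : R) :
  continuous f -> closed [set z | f z <= r].
Proof.
move=> cf.
exact: (@preimage_closed _ _ f [set t : R | t <= r] (fun z _ => cf z)
  (@closed_le R r)).
Qed.

Lemma compact_ball2 r : compact (@ball2 R n r).
Proof.
apply: bounded_closed_compact.
  exists r; split=> [|M rM z /= zr]; first exact: num_real.
  exact: le_trans (mx_norm_le_norm2 _) (le_trans zr (ltW rM)).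
exact: (closed_sublevel _ _ continuous_norm2).
Qed.

Lemma compact_ball_slab tau v : compact (ball_slab tau v).
Proof.
apply: (@subclosed_compact _ _ (@ball2 R n 1)); last 2 first.
- exact: compact_ball2.
- by move=> z [].
apply: (@closedI _ (@ball2 R n 1) [set z | `|dotv z v| <= tau]).
  exact: (closed_sublevel _ _ continuous_norm2).
apply: closed_sublevel => z; under eq_fun do rewrite dotvC.
apply: (@continuous_comp _ _ _ (dotv v)); first exact: continuous_dotv.
exact: norm_continuous.
Qed.

Lemma ball_slab_convex tau v x y t :
  ball_slab tau v x -> ball_slab tau v y -> 0 <= t -> t <= 1 ->
  ball_slab tau v (x + t *: (y - x)).
Proof.
move=> [x1 xv] [y1 yv] t0 t1; split; first exact: (ball2_convex 1).
move: xv yv; rewrite dotvDl dotvZl dotvBl !ler_norml => /andP[a b] /andP[c d].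
by apply/andP; split; nra.
Qed.

Lemma ball_slab0 tau v : 0 <= tau -> ball_slab tau v 0.
Proof. by move=> tau0; split; rewrite ?norm20 // dotvC dotv0 normr0. Qed.

Lemma ball_slab_neq0 tau v : 0 <= tau -> ball_slab tau v !=set0.
Proof. by exists 0; exact: ball_slab0. Qed.

Lemma ball2_support_point gamma x : 0 < gamma ->
  is_support_point (ball2 1) gamma x ((Num.max gamma (norm2 x))^-1 *: x).
Proof.
move=> g0; set m := Num.max gamma (norm2 x).
have m0 : 0 < m by rewrite lt_max g0.
split.
  rewrite /ball2 /= norm2Z gtr0_norm ?invr_gt0 //.
  by rewrite mulrC ler_pdivrMr // mul1r le_max lexx orbT.
move=> w w1; rewrite /penalized !dotvZl dotvZr -!norm2_sqr.
have := dotv_le w x; move: w1 (norm2_ge0 w) (norm2_ge0 x); rewrite /ball2 /=.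
rewrite /m; move: (norm2 w) (norm2 x) (dotv w x) => t r d t1 t0 r0 h.
(* By Cauchy-Schwarz only t = |w| matters: it remains to maximize a quadratic over [0, 1]. *)
apply: (@le_trans _ _ (t * r - gamma / 2 * t ^+ 2)); first lra.
case: (leP gamma r) => gr.
  have r0' : 0 < r by exact: lt_le_trans gr.
  have -> : r^-1 * r ^+ 2 - gamma / 2 * (r^-1 * (r^-1 * r ^+ 2)) = r - gamma /
    2.
    by field; rewrite gt_eqF.
  have : 0 <= (1 - t) * (r - gamma * (1 + t) / 2) by apply: mulr_ge0; nra.
  lra.
have -> : gamma^-1 * r ^+ 2 - gamma / 2 * (gamma^-1 * (gamma^-1 * r ^+ 2)) =
    r ^+ 2 / 2 / gamma by field; rewrite gt_eqF.
by rewrite ler_pdivlMr //; have := sqr_ge0 (t * gamma - r); nra.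
Qed.

(* For [x] almost orthogonal to [v] the slab constraint is inactive, so that
   [reg_support (ball_slab tau v)] carries no information on [v] there. *)
Lemma reg_support_ball_slab gamma tau v x : 0 < gamma -> 0 <= tau ->
  `|dotv x v| <= tau * norm2 x ->
  reg_support (ball_slab tau v) gamma x = reg_support (ball2 1) gamma x.
Proof.
move=> g0 tau0 xv; have bx := ball2_support_point gamma x g0.
rewrite (reg_supportE _ _ _ _ bx); apply: reg_supportE.
case: bx => b1 b2; split=> [|w [w1 _]]; last exact: b2.
split=> //; rewrite dotvZl normrM ger0_norm ?invr_ge0 ?le_max ?norm2_ge0 ?orbT
  //.
rewrite mulrC ler_pdivrMr ?lt_max ?g0 //; apply: le_trans xv _.
by rewrite ler_wpM2l // le_max lexx orbT.
Qed.

(** The regularized norm is the Huber function of |x|: equality holds beyond radius gamma, and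
    within it the claim is (gamma - |x|)^2 >= 0. *)
Lemma reg_support_ball2_ge gamma x : 0 < gamma ->
  norm2 x - gamma / 2 <= reg_support (ball2 1) gamma x.
Proof.
move=> g0; rewrite (reg_supportE _ _ _ _ (ball2_support_point _ _ g0)).
rewrite /penalized !dotvZl dotvZr -!norm2_sqr.
move: (norm2 x) (norm2_ge0 x) => r r0.
case: (leP gamma r) => gr.
  by rewrite le_eqVlt; apply/orP; left; apply/eqP; field;
    rewrite gt_eqF ?(lt_le_trans g0).
have -> : gamma^-1 * r ^+ 2 - gamma / 2 * (gamma^-1 * (gamma^-1 * r ^+ 2)) =
    r ^+ 2 / 2 / gamma by field; rewrite gt_eqF.
by rewrite ler_pdivlMr //; have := sqr_ge0 (gamma - r); nra.
Qed.

End RegularizedSupport.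

(** * The hard function *)

Section Huber.
Context {R : realType}.
Implicit Types t u : R.

Definition clip t : R := Num.min 1 (Num.max 0 t).

(** A smoothed positive part, with derivative [clip]: 0 for t <= 0, t^2 / 2 on [0, 1], t - 1 / 2
    beyond. *)
Definition huber t : R := clip t * t - clip t ^+ 2 / 2.

Variant clip_spec t : R -> Prop :=
| ClipLow of t <= 0 : clip_spec t 0
| ClipMid of 0 <= t & t <= 1 : clip_spec t t
| ClipHigh of 1 <= t : clip_spec t 1.

Lemma clipP t : clip_spec t (clip t).
Proof.
rewrite /clip; case: (leP t 0) => [t0|/ltW t0].
  by rewrite (min_idPr ler01); constructor.
by case: (leP 1 t) => [t1|/ltW t1]; constructor.
Qed.

Lemma clip_ge0 t : 0 <= clip t.
Proof. by case: clipP. Qed.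

Lemma clip_le1 t : clip t <= 1.
Proof. by case: clipP. Qed.

Lemma clip_lipschitz t u : `|clip t - clip u| <= `|t - u|.
Proof.
wlog tu : t u / t <= u.
  move=> h; case: (leP t u) => [/h //|/ltW /h]; by rewrite distrC (distrC u).
rewrite (distrC t) (ger0_norm (_ : 0 <= u - t)) ?subr_ge0 //.
by rewrite ler_norml; apply/andP; split; case: (clipP t); case: (clipP u); lra.
Qed.

Lemma huber_subgradient t u : huber t + clip t * (u - t) <= huber u.
Proof.
rewrite /huber; have := sqr_ge0 (u - t); have := sqr_ge0 (1 - t).
have := sqr_ge0 (1 - u).
by case: (clipP t) => [t0|t0 t1|t1]; case: (clipP u) => [u0|u0 u1|u1]; nra.
Qed.

Lemma huber_eq0 t : t <= 0 -> huber t = 0.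
Proof. by move=> t0; rewrite /huber; case: clipP; nra. Qed.

Lemma huber_ge0 t : 0 <= huber t.
Proof. by rewrite /huber; case: clipP; nra. Qed.

Lemma huberE t : 1 <= t -> huber t = t - 1 / 2.
Proof. by move=> t1; rewrite /huber; case: clipP; nra. Qed.

(** The slopes of [huber] lie in [0, 1], so those of huber t - t lie in [-1, 0]. *)
Lemma huber_shift t a : `|huber (t + a) - a - huber t| <= `|a|.
Proof.
have h1 := huber_subgradient t (t + a); have h2 := huber_subgradient (t + a) t.
have t0 := clip_ge0 t; have t1 := clip_le1 t.
have u0 := clip_ge0 (t + a); have u1 := clip_le1 (t + a).
rewrite ler_norml; case: (ger0P a) => a0; apply/andP; split; nra.
Qed.

End Huber.

Section HardFunction.
Context {R : realType} {n : nat} {N tau : R} {v : 'rV[R]_n}.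
Hypothesis N3 : 3 <= N.
Hypothesis tau0 : 0 <= tau.
Hypothesis v1 : norm2 v = 1.

Let N0 : 0 < N. Proof. exact: lt_le_trans N3. Qed.
Let Ni0 : 0 < N^-1. Proof. by rewrite invr_gt0. Qed.

(** Writing max (A, B) = B + max (0, A - B) with A the regularized cone minus 4 and B = - 3 <v, x>,
    this is A - B; [hard] replaces the positive part by [huber]. *)
Definition hard_radial (x : 'rV[R]_n) : R :=
  N * reg_support (ball_slab tau v) N^-1 x + 3 * dotv v x - 4.

Definition hard (x : 'rV[R]_n) : R := huber (hard_radial x) - 3 * dotv v x.

Definition hard_radial_grad (x : 'rV[R]_n) : 'rV[R]_n :=
  N *: support_point (ball_slab tau v) N^-1 x + 3 *: v.

Definition hard_grad (x : 'rV[R]_n) : 'rV[R]_n :=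
  clip (hard_radial x) *: hard_radial_grad x - 3 *: v.

Definition hard_base (x : 'rV[R]_n) : R :=
  huber (N * reg_support (ball2 1) N^-1 x - 4).

Let slab_selection := @reg_support_selection _ _ (ball_slab tau v) N^-1
  (ball_slab_neq0 tau v tau0) (compact_ball_slab tau v).
Let slab_lipschitz :=
  support_point_lipschitz Ni0 (ball_slab_neq0 tau v tau0)
    (compact_ball_slab tau v) (ball_slab_convex tau v).
Let slab_mem := @support_point_mem _ _ (ball_slab tau v) N^-1
  (ball_slab_neq0 tau v tau0) (compact_ball_slab tau v).

Lemma hard_radial_selection :
  subgradient_selection 0 hard_radial hard_radial_grad.
Proof.
move=> x y; rewrite mul0r mul0r addr0.
have := slab_selection x y; rewrite mul0r mul0r addr0 -(ler_pM2l N0).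
rewrite /hard_radial /hard_radial_grad dotvDl !dotvZl !dotvBr; lra.
Qed.

(** Chain rule for a convex nondecreasing outer function: the subgradient inequality of
    [hard_radial] is multiplied by [clip], which is nonnegative. *)
Lemma hard_selection : subgradient_selection 0 hard hard_grad.
Proof.
move=> x y; rewrite mul0r mul0r addr0 /hard /hard_grad.
have := huber_subgradient (hard_radial x) (hard_radial y).
have := ler_wpM2l (clip_ge0 (hard_radial x)) (selection_taylor (lexx 0)
  hard_radial_selection x y).
rewrite dotvBl !dotvZl !dotvBr; lra.
Qed.

Lemma hard_radial_grad_le x : norm2 (hard_radial_grad x) <= N + 3.
Proof.
have [p1 _] := slab_mem x.
apply: le_trans (norm2D _ _) _; rewrite !norm2Z v1 (gtr0_norm N0).
by rewrite ger0_norm // lerD // -[leRHS]mulr1 ler_wpM2l // ltW.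
Qed.

Lemma hard_radial_lipschitz x y :
  `|hard_radial x - hard_radial y| <= (N + 3) * norm2 (x - y).
Proof.
exact: (selection_lipschitz (lexx 0) hard_radial_selection _
  hard_radial_grad_le).
Qed.

Lemma hard_grad_lipschitz : lipschitz_map_on setT (5 * N ^+ 2) hard_grad.
Proof.
move=> x y _ _; rewrite /hard_grad.
set a := clip _; set b := clip _; set p := hard_radial_grad x.
set q := hard_radial_grad y.
(* The first term contributes (N + 3)^2, at most 4 N^2 as N >= 3, and the second N^2, which explains
   the factor 5. *)
have -> : a *: p - 3 *: v - (b *: q - 3 *: v) = (a - b) *: p + b *: (p - q).
  by apply/rowP => i; rewrite !mxE; ring.
have ab : `|a - b| <= (N + 3) * norm2 (x - y).
  exact: le_trans (clip_lipschitz _ _) (hard_radial_lipschitz x y).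
have pq : norm2 (p - q) <= N ^+ 2 * norm2 (x - y).
  have -> : p - q = N *: (support_point (ball_slab tau v) N^-1 x -
      support_point (ball_slab tau v) N^-1 y).
    by apply/rowP => i; rewrite !mxE; ring.
  rewrite norm2Z gtr0_norm // expr2 -mulrA ler_wpM2l ?(ltW N0) //.
  by have := slab_lipschitz x y I I; rewrite invrK.
apply: le_trans (norm2D _ _) _; rewrite !norm2Z (ger0_norm (clip_ge0 _)) -/b.
have p1 := hard_radial_grad_le x; rewrite -/p in p1.
have b0 := clip_ge0 (hard_radial y); have b1 := clip_le1 (hard_radial y).
rewrite -/b in b0 b1.
have h1 := ler_pM (normr_ge0 _) (norm2_ge0 _) ab p1.
have h2 := ler_pM b0 (norm2_ge0 _) b1 pq.
apply: (le_trans (lerD h1 h2)); rewrite mul1r.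
have := norm2_ge0 (x - y); move: (norm2 _) => d d0.
have : 0 <= ((2 * N) ^+ 2 - (N + 3) ^+ 2) * d by apply: mulr_ge0 => //;
  have := N3; nra.
lra.
Qed.

Lemma hard_ge x : - 3 * dotv v x <= hard x.
Proof. by rewrite /hard; have := huber_ge0 (hard_radial x); lra. Qed.

(** At v the slab caps the support function by tau, so [hard_radial] is at most N tau + 3 - 4 <= 0
    and only the linear term survives. *)
Lemma hard_at_direction : N * tau <= 1 -> hard v = - 3.
Proof.
move=> Nt; rewrite /hard -norm2_sqr v1 huber_eq0;
  first by rewrite expr1n mulr1 sub0r.
rewrite /hard_radial -norm2_sqr v1.
have [_] := slab_mem v; rewrite ler_norml => /andP[_ p2].
have : reg_support (ball_slab tau v) N^-1 v <= tau.
  rewrite /reg_support /penalized.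
  have : 0 <= N^-1 / 2 * dotv (support_point (ball_slab tau v) N^-1 v)
      (support_point (ball_slab tau v) N^-1 v).
    by rewrite !mulr_ge0 ?dotv_ge0 // ltW.
  lra.
rewrite -(ler_pM2l N0); lra.
Qed.

Lemma hard_near_base x : tau <= 1 / 3 -> `|dotv x v| <= tau * norm2 x ->
  `|hard x - hard_base x| <= 25 * (tau / N).
Proof.
move=> tau1 xv; rewrite /hard /hard_base /hard_radial.
rewrite reg_support_ball_slab //.
have g := reg_support_ball2_ge N^-1 x Ni0.
move: xv; rewrite dotvC; set s := dotv v x => xv.
have Ng : N * norm2 x - 1 / 2 <= N * reg_support (ball2 1) N^-1 x.
  apply: le_trans (ler_wpM2l (ltW N0) g).
  by rewrite le_eqVlt; apply/orP; left; apply/eqP; field; rewrite gt_eqF.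
set t := N * _; rewrite -/t in Ng.
have -> : t + 3 * s - 4 = t - 4 + 3 * s by ring.
(* Far out, both [huber] terms are in their affine range and the difference is exactly 0. Otherwise
   |x| is O(1 / N) and [huber_shift] costs 3 |s| <= 3 tau |x|. *)
case: (leP (5 + 3 * `|s|) t) => st.
  have := ler_norm s; have := ler_norm (- s); rewrite normrN => s1 s2.
  have s0 := normr_ge0 s.
  rewrite (huberE (t - 4 + 3 * s)); last by lra.
  rewrite (huberE (t - 4)); last by lra.
  rewrite (_ : _ - _ = 0) ?normr0; last by ring.
  by rewrite !mulr_ge0 // ltW.
apply: le_trans (huber_shift _ _) _; rewrite normrM (ger0_norm (_ : 0 <= 3)) //.
have x0 := norm2_ge0 x.
(* As 3 |s| <= |x| <= N |x| / 3, the case condition yields (2 / 3) N |x| <= 11 / 2; then 3 * 33 / 4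
   <= 25. *)
have h : N * norm2 x <= 33 / 4.
  have := ler_wpM2r x0 N3; have := ler_wpM2r x0 tau1; lra.
rewrite mulrA ler_pdivlMr //.
have := ler_wpM2l tau0 h; have := ler_wpM2l (ltW N0) xv; have := tau0; lra.
Qed.

End HardFunction.

(** * Adding a quadratic and rescaling *)

Section QuadraticPerturbation.
Context {R : realType} {n : nat} {h : 'rV[R]_n -> R} {p : 'rV[R]_n -> 'rV[R]_n}.
Context {mu rho K : R}.
Hypothesis mu0 : 0 <= mu.
Hypothesis rho0 : 0 < rho.

Definition perturb (mu rho : R) (h : 'rV[R]_n -> R) (x : 'rV[R]_n) : R :=
  mu / 2 * norm2 x ^+ 2 + mu * rho ^+ 2 * h (rho^-1 *: x).

Definition perturb_grad (x : 'rV[R]_n) : 'rV[R]_n :=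
  mu *: (x + rho *: p (rho^-1 *: x)).

Lemma perturb_selection : subgradient_selection 0 h p ->
  subgradient_selection mu (perturb mu rho h) perturb_grad.
Proof.
move=> hp x y; rewrite /perturb /perturb_grad.
have := hp (rho^-1 *: x) (rho^-1 *: y); rewrite mul0r mul0r addr0.
have mr : 0 <= mu * rho ^+ 2 by rewrite mulr_ge0 ?exprn_ge0 // ltW.
move=> /(ler_wpM2l mr); rewrite -scalerBr dotvZr mulrDr.
rewrite (_ : mu * rho ^+ 2 * (rho^-1 * _) = mu * rho * dotv (p (rho^-1 *: x))
  (y - x)); last first.
  by field; rewrite gt_eqF.
rewrite !norm2_sqr dotvZl dotvDl dotvZl !dotvBr !dotvBl (dotvC y x); lra.
Qed.

(** The inner factor 1 / rho and the outer factor rho cancel, so the scale does not affect the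
    Lipschitz constant. *)
Lemma perturb_grad_lipschitz : lipschitz_map_on setT K p ->
  lipschitz_map_on setT (mu * (1 + K)) perturb_grad.
Proof.
move=> pK x y _ _; rewrite /perturb_grad -scalerBr norm2Z ger0_norm // -mulrA.
rewrite ler_wpM2l //; set a := p _; set b := p _.
rewrite (_ : _ - _ = (x - y) + rho *: (a - b)); last first.
  by apply/rowP => i; rewrite !mxE; ring.
apply: le_trans (norm2D _ _) _; rewrite mulrDl mul1r lerD2l norm2Z gtr0_norm //.
have := pK (rho^-1 *: x) (rho^-1 *: y) I I; rewrite -scalerBr norm2Z.
rewrite -/a -/b gtr0_norm ?invr_gt0 // mulrCA => /(ler_wpM2l (ltW rho0)).
by rewrite mulVKf ?gt_eqF.
Qed.

End QuadraticPerturbation.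

(** * Random sign vectors *)

Section Rademacher.
Context {R : realType}.

Lemma expR_le_invB (t : R) : t < 1 -> expR t <= (1 - t)^-1.
Proof.
move=> t1; rewrite -[expR t]invrK -expRN lef_pV2 ?posrE ?subr_gt0 ?expR_gt0 //.
exact: expR_ge1Dx.
Qed.

(** A sub-Gaussian bound on cosh with a crude constant. If t^2 >= 1 / 2 then |t| <= 2 t^2; otherwise
    exp (t) <= 1 / (1 - t) reduces it to 1 / (1 - t^2) <= 1 + 2 t^2. *)
Lemma expRD_expRN_le (t : R) : expR t + expR (- t) <= 2 * expR (2 * t ^+ 2).
Proof.
wlog t0 : t / 0 <= t.
  move=> h; case: (leP 0 t) => [/h //|/ltW t0].
  by have := h (- t); rewrite opprK sqrrN addrC; apply; rewrite oppr_ge0.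
case: (leP (1 / 2) (t ^+ 2)) => ht.
  have t2 : t <= 2 * t ^+ 2 by nra.
  have h1 : expR t <= expR (2 * t ^+ 2) by rewrite ler_expR.
  have h2 : expR (- t) <= expR (2 * t ^+ 2) by rewrite ler_expR; lra.
  lra.
have t1 : t < 1 by nra.
have h1 := expR_le_invB t t1; have h2 := expR_le_invB (- t) ltac:(lra).
apply: (@le_trans _ _ (2 * (1 + 2 * t ^+ 2))); last first.
  by rewrite ler_wpM2l // expR_ge1Dx.
apply: le_trans (lerD h1 h2) _; rewrite opprK.
have -> : (1 - t)^-1 + (1 + t)^-1 = 2 / (1 - t ^+ 2).
  by field; apply/andP; split; rewrite gt_eqF //; nra.
rewrite ler_pdivrMr; nra.
Qed.

(** The moment generating function of independent signs factorizes; here it is unnormalized, since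
    events are counted. *)
Lemma sum_expR_signs n (x : 'I_n -> R) :
  \sum_(e : {ffun 'I_n -> bool}) expR (\sum_i (-1) ^+ e i * x i) =
  \prod_i (expR (x i) + expR (- x i)).
Proof.
transitivity (\sum_(e : {ffun 'I_n -> bool}) \prod_i expR ((-1) ^+ e i * x i)).
  by apply: eq_bigr => e _; rewrite expR_sum.
rewrite -(bigA_distr_bigA (fun i (b : bool) => expR ((-1) ^+ b * x i))).
by apply: eq_bigr => i _; rewrite big_bool /= expr1 expr0 mulN1r mul1r addrC.
Qed.

Definition rademacher n (e : {ffun 'I_n -> bool}) : 'rV[R]_n :=
  \row_i ((Num.sqrt n%:R)^-1 * (-1) ^+ e i).

Lemma norm2_rademacher n (e : {ffun 'I_n -> bool}) : (0 < n)%N ->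
  norm2 (rademacher n e) = 1.
Proof.
move=> n0; apply/eqP; rewrite -(@eqrXn2 _ 2) // norm2_sqr expr1n; apply/eqP.
transitivity (\sum_(i < n) (n%:R^-1 : R)).
  apply: eq_bigr => i _; rewrite !mxE mulrACA -expr2 -expr2 exprVn.
  by rewrite sqr_sqrtr // -exprM muln2 -mul2n exprM sqrrN !expr1n mulr1.
by rewrite sumr_const card_ord -[LHS]mulr_natr mulVf // pnatr_eq0 -lt0n.
Qed.

Lemma rademacher_tail n (tau : R) (x : 'rV[R]_n) : 0 <= tau ->
  #|[pred e | tau * norm2 x < dotv x (rademacher n e)]|%:R <=
  expR (- (n%:R * tau ^+ 2 / 8)) * (2 ^ n)%:R.
Proof.
move=> tau0; set E := [pred e | _].
have [x0|x0] := eqVneq (norm2 x) 0.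
  rewrite eq_card0 ?mulr_ge0 ?expR_ge0 // => e.
  by rewrite !inE x0 mulr0 (norm2_eq0 x x0) dotvC dotv0 ltxx.
have x1 : 0 < norm2 x by rewrite lt_def x0 norm2_ge0.
(* Chernoff's method: this value minimizes 2 lam^2 |x|^2 - lam sqrt (n) tau |x|, with minimum - n
   tau^2 / 8. *)
set lam := Num.sqrt n%:R * tau / (4 * norm2 x).
have lam0 : 0 <= lam by rewrite !mulr_ge0 ?invr_ge0 ?sqrtr_ge0 ?mulr_ge0.
have h1 : \sum_(e : {ffun 'I_n -> bool}) expR (\sum_i (-1) ^+ e i * (lam * x 0
  i)) <=
    (2 ^ n)%:R * expR (n%:R * tau ^+ 2 / 8).
  rewrite sum_expR_signs.
  apply: (@le_trans _ _ (\prod_(i < n) (2 * expR (2 * (lam * x 0 i) ^+ 2)))).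
    apply: ler_prod => i _; rewrite expRD_expRN_le andbT.
    by rewrite addr_ge0 ?expR_ge0.
  rewrite big_split /= prodr_const card_ord -expR_sum natrX ler_wpM2l
    ?exprn_ge0 //.
  rewrite ler_expR -mulr_sumr.
  rewrite (eq_bigr (fun i => lam ^+ 2 * (x 0 i * x 0 i))); last first.
    by move=> i _; rewrite exprMn [x 0 i ^+ 2]expr2.
  rewrite -mulr_sumr -/(dotv x x) -norm2_sqr /lam.
  rewrite !exprMn exprVn sqr_sqrtr // exprMn le_eqVlt; apply/orP; left.
  by apply/eqP; field; rewrite gt_eqF.
have h2 : #|E|%:R * expR (n%:R * tau ^+ 2 / 4) <=
    \sum_(e : {ffun 'I_n -> bool}) expR (\sum_i (-1) ^+ e i * (lam * x 0 i)).
  rewrite mulr_natl -sumr_const.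
  rewrite [leRHS](bigID (mem E)) /= ler_wpDr //.
    by apply: sumr_ge0 => e _; exact: expR_ge0.
  apply: ler_sum => e; rewrite inE => he; rewrite ler_expR.
  have [n0|n0] := eqVneq n 0%N.
    by subst n; rewrite mul0r mul0r big_ord0.
  have sn : 0 < Num.sqrt n%:R :> R by rewrite sqrtr_gt0 ltr0n lt0n.
  have -> : \sum_i (-1) ^+ e i * (lam * x 0 i) =
      lam * Num.sqrt n%:R * dotv x (rademacher n e).
    rewrite /dotv mulr_sumr; apply: eq_bigr => i _; rewrite !mxE.
    by field; rewrite gt_eqF.
  have ls0 : 0 <= lam * Num.sqrt n%:R by rewrite mulr_ge0 // ltW.
  apply: le_trans (ler_wpM2l ls0 (ltW he)); rewrite /lam.
  have sq : n%:R = Num.sqrt n%:R ^+ 2 :> R by rewrite sqr_sqrtr.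
  rewrite {1}sq le_eqVlt; apply/orP; left.
  by apply/eqP; field; rewrite gt_eqF.
have h3 := le_trans h2 h1.
rewrite -(@ler_pM2r _ (expR (n%:R * tau ^+ 2 / 4))) ?expR_gt0 //.
apply: le_trans h3 _; rewrite [leRHS]mulrAC -expRD mulrC ler_wpM2r //.
by rewrite ler_expR; lra.
Qed.

Lemma rademacher_correlated n (tau : R) (x : 'rV[R]_n) : 0 <= tau ->
  #|[pred e | tau * norm2 x < `|dotv x (rademacher n e)|]|%:R <=
  2 * expR (- (n%:R * tau ^+ 2 / 8)) * (2 ^ n)%:R.
Proof.
move=> tau0; set E := [pred e | _].
have h1 := rademacher_tail n tau x tau0.
have := rademacher_tail n tau (- x) tau0; rewrite norm2N => h2.
apply: (@le_trans _ _ (#|[pred e | tau * norm2 x < dotv x (rademacher n e)]|%:R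
  +
  #|[pred e | tau * norm2 x < dotv (- x) (rademacher n e)]|%:R)); last first.
  by rewrite -mulrA mulrDl mul1r lerD.
rewrite -natrD ler_nat; rewrite -cardUI.
apply: leq_trans (leq_addr _ _); apply: subset_leq_card;
  apply/fintype.subsetP => e.
by rewrite !inE dotvNl ltr_normr.
Qed.

End Rademacher.

(** * Resisting oracles *)

Lemma continuous_borel_measurable_fun {R : realType} {n : nat}
    (D : set (borelRn R n)) (f : 'rV[R]_n -> R) :
  continuous f -> measurable_fun D (f : borelRn R n -> R).
Proof.
move=> /continuousP cf mD; apply: (measurability _ (RGenOpens.measurableE R))
  => //.
move=> _ [_ [a [b ->] <-]]; apply: measurableI => //.
by apply: sub_sigma_algebra; apply: cf; exact: interval_open.
Qed.

(** Only the answers along the run against [O] matter. Splitting the list expresses membership over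
    a bare type [X]. *)
Lemma eq_on_queries_output {R X : Type} (O O' : X -> R) (t : algo R X)
    (C : X -> Prop) :
  (forall x, C x -> O' x = O x) ->
  (forall s1 x s2, queries O t = s1 ++ x :: s2 -> C x) ->
  output O' t = output O t.
Proof.
move=> CO; elim: t => [//|x k IH] /= h; rewrite CO; last exact: (h [::] x).
by apply: IH => s1 y s2 e; apply: (h (x :: s1)); rewrite e.
Qed.

Lemma sum_probability_le {R : realType} d (W : measurableType d)
    (P : probability W R) (V : finType) (E : V -> set W) (B : R) :
  (forall v, measurable (E v)) -> (forall w, \sum_v \1_(E v) w <= B) ->
  (\sum_v P (E v) <= B%:E)%E.
Proof.
move=> mE EB.
have -> : (\sum_v P (E v) = \int[P]_w (\sum_v \1_(E v) w)%:E)%E.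
  under eq_integral do rewrite -sumEFin.
  rewrite ge0_integral_sum //=.
  - by apply: eq_bigr => v _; rewrite integral_indic ?setIT.
  - by move=> v; apply/measurable_EFinP; exact: measurable_indic.
apply: (@le_trans _ _ (\int[P]_w (cst B%:E w))%E).
  apply: ge0_le_integral => //=.
  - by move=> w _; rewrite lee_fin sumr_ge0.
  - apply/measurable_EFinP; apply: measurable_sum => v; exact: measurable_indic.
  - by move=> w _; rewrite lee_fin EB.
by rewrite integral_cst // [X in (_ * X)%E](probability_setT P) mule1.
Qed.

Section ResistingOracle.
Context {R : realType} {n : nat} {S : set 'rV[R]_n}.
Context {F : set ('rV[R]_n -> R)} {V : finType} {f : V -> 'rV[R]_n -> R}.
Context {b : 'rV[R]_n -> R} {C : V -> pred 'rV[R]_n} {eps delta q : R}.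
Hypothesis delta0 : 0 <= delta.
Hypothesis Ff : forall v, F (f v).
Hypothesis cf : forall v, continuous (f v).
Hypothesis cb : continuous b.
Hypothesis near_base : forall v x, S x -> ~~ C v x -> `|f v x - b x| <= delta.
Hypothesis far_from_inf : forall v x, S x -> ~~ C v x ->
  eps < f v x - inf (f v @` S).
Hypothesis rare : forall x, #|[pred v | C v x]|%:R <= q * #|V|%:R.

(* Truncating [b] to the band of width [delta] around [f v], rather than
   switching to [f v] on the correlated points, keeps the oracle continuous,
   hence Borel. *)
Definition resisting_oracle v x : R :=
  Num.max (f v x - delta) (Num.min (f v x + delta) (b x)).

Lemma resisting_oracle_noisy v : noisy_oracle S delta (f v) (resisting_oracle
  v).
Proof.
apply: ge_ereal_sup => _ [x _ <-]; rewrite lee_fin /resisting_oracle.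
rewrite ler_distl le_max lexx /= ge_max; apply/andP; split.
  by have := delta0; lra.
by rewrite ge_min lexx.
Qed.

Lemma resisting_oracle_measurable v :
  measurable_fun (S : set (borelRn R n)) (resisting_oracle v : borelRn R n ->
    R).
Proof.
apply: measurable_maxr.
  apply: measurable_funB; last exact: measurable_cst.
  exact: (continuous_borel_measurable_fun _ _ (cf v)).
apply: measurable_minr.
  apply: measurable_funD; last exact: measurable_cst.
  exact: (continuous_borel_measurable_fun _ _ (cf v)).
exact: (continuous_borel_measurable_fun _ _ cb).
Qed.

Lemma resisting_oracleE v x : S x -> ~~ C v x -> resisting_oracle v x = b x.
Proof.
move=> Sx Cx; rewrite /resisting_oracle.
have := near_base v x Sx Cx; rewrite ler_distlC => /andP[h1 h2].
by rewrite (min_idPr _) ?(max_idPr _) //; lra.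
Qed.

(** Fix the run against [b]. If v is correlated with none of its queries nor with its output, the
    oracle for v produces the same run, which fails for v. So each success is charged to one of T +
    1 points, and each point is charged at most q |V| times. *)
Lemma resisting_success (A : rand_algo R 'rV[R]_n) T w :
  admissible S T (ra_algo w) ->
  \sum_v \1_(success S eps (f v) (resisting_oracle v) A) w <=
  T.+1%:R * q * #|V|%:R.
Proof.
move=> adm; have [sT qS oS] := adm b.
set pts := output b (ra_algo w) :: queries b (ra_algo w).
have ptsS x : x \in pts -> S x by rewrite inE => /orP[/eqP -> //|]; exact: qS.
have key v : \1_(success S eps (f v) (resisting_oracle v) A) w <=
    \sum_(x <- pts) (C v x)%:R :> R.
  have pos : 0 <= \sum_(x <- pts) (C v x)%:R :> R by apply: sumr_ge0.
  rewrite indicE; have [ws|_] := boolP (w \in _); last by [].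
  have [/hasP[x xp Cx]|/hasPn nC] := boolP (has (C v) pts).
    by rewrite (big_rem x xp) /= Cx lerDl; exact: sumr_ge0.
  have out : output (resisting_oracle v) (ra_algo w) = output b (ra_algo w).
    apply: (eq_on_queries_output _ _ _ (fun x => x \in pts)).
    - by move=> x xp; apply: resisting_oracleE; [exact: ptsS | exact: nC].
    - by move=> s1 x s2 e; rewrite /pts e inE mem_cat mem_head !orbT.
  have y0 : output b (ra_algo w) \in pts by exact: mem_head.
  have := far_from_inf v _ (ptsS _ y0) (nC _ y0).
  by move: ws; rewrite inE /success /= out ltNge => ->.
apply: le_trans (ler_sum _ (fun v _ => key v)) _.
rewrite exchange_big /=.
apply: (@le_trans _ _ (\sum_(x <- pts) q * #|V|%:R)).
  apply: ler_sum => x _; apply: le_trans (rare x).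
  rewrite -natr_sum ler_nat -sum1_card [leqRHS]big_mkcond.
  by apply: leq_sum => v _; rewrite inE /=; case: (C v x).
rewrite big_const_seq count_predT iter_addr_0 -[leLHS]mulr_natl -mulrA.
(* [rare] at any point shows that q |V| is nonnegative. *)
by rewrite ler_wpM2r ?ler_nat // (le_trans _ (rare 0)).
Qed.

(** Yao's averaging: success probabilities are summed over v and the sum is bounded for each
    internal random outcome. Borel measurability of the oracles makes each success an event. *)
Lemma resisting_bound (A : rand_algo R 'rV[R]_n) T beta : (0 < #|V|)%N ->
  solves S F eps beta delta T A -> 1 - beta <= T.+1%:R * q.
Proof.
move=> V0 [adm sol].
pose E v := success S eps (f v) (resisting_oracle v) A.
have mE v : measurable (E v).
  have [+ _] := sol _ _ (Ff v) (resisting_oracle_noisy v); apply.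
  exact: resisting_oracle_measurable.
have PE v : ((1 - beta)%:E <= ra_prob A (E v))%E.
  by have [_] := sol _ _ (Ff v) (resisting_oracle_noisy v); apply; exact: mE.
have h1 : ((\sum_(v : V) (1 - beta))%:E <= \sum_v ra_prob A (E v))%E.
  by rewrite -sumEFin; apply: lee_sum => v _; exact: PE.
have h2 := sum_probability_le _ _ (ra_prob A) _ E _ mE
  (fun w => resisting_success A T w (adm w)).
have := le_trans h1 h2; rewrite lee_fin sumr_const -[leLHS]mulr_natr.
by rewrite ler_pM2r // ltr0n.
Qed.

End ResistingOracle.

(** * The hard instance in the ball *)

Lemma continuous_hard_base {R : realType} {n : nat} (N : R) :
  0 < N -> continuous (@hard_base R n N).
Proof.
move=> N0; have Ni0 : 0 < N^-1 by rewrite invr_gt0.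
have b0 : @ball2 R n 1 !=set0 by exists 0; rewrite /ball2 /= norm20.
have bc := @compact_ball2 R n 1.
apply: (@lipschitz_continuous _ _ _ N) => x y.
have sel := reg_support_selection b0 bc (gamma := N^-1).
have := selection_lipschitz (lexx 0) sel 1 (support_point_mem b0 bc) x y.
rewrite mul1r -(ler_pM2l N0) /hard_base; apply: le_trans.
set s := reg_support _ _ x; set t := reg_support _ _ y.
have h1 := huber_subgradient (N * s - 4) (N * t - 4).
have h2 := huber_subgradient (N * t - 4) (N * s - 4).
have -> : N * `|s - t| = `|(N * s - 4) - (N * t - 4)|.
  by rewrite -[in LHS](gtr0_norm N0) -normrM; congr `|_|; ring.
move: h1 h2; set a := N * s - 4; set b := N * t - 4 => h1 h2.
have := clip_ge0 a; have := clip_le1 a; have := clip_ge0 b; have := clip_le1 b.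
move=> b2 b1 a2 a1; rewrite ler_norml.
by case: (ger0P (a - b)) => ab; apply/andP; split; nra.
Qed.

Lemma continuous_perturb {R : realType} {n : nat} (mu rho : R)
    (h : 'rV[R]_n -> R) : continuous h -> continuous (perturb mu rho h).
Proof.
move=> ch x; rewrite /perturb.
have cs : continuous (fun x : 'rV[R]_n => rho^-1 *: x).
  apply: (@lipschitz_continuous _ _ _ `|rho^-1|) => y z.
  by rewrite -scalerBr -norm2Z mx_norm_le_norm2.
apply: (cvgD (FF := nbhs_filter x)).
  apply: (cvgM (FF := nbhs_filter x)); first exact: cvg_cst.
  under eq_cvg do rewrite norm2_sqr; rewrite norm2_sqr; exact: continuous_dotvv.
apply: (cvgM (FF := nbhs_filter x)); first exact: cvg_cst.
by apply: (@continuous_comp _ _ _ (fun x : 'rV[R]_n => rho^-1 *: x) h);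
  [exact: cs | exact: ch].
Qed.

Section HardInstance.
Context {R : realType} {n : nat} {L mu r rho N tau delta : R}.
Hypothesis n0 : (0 < n)%N.
Hypothesis mu0 : 0 < mu.
Hypothesis rho0 : 0 < rho.
Hypothesis rhor : rho <= r.
Hypothesis N3 : 3 <= N.
Hypothesis tau0 : 0 <= tau.
Hypothesis tau1 : tau <= 1 / 3.
Hypothesis Ntau : N * tau <= 1.
Hypothesis NL : mu * (1 + 5 * N ^+ 2) <= L.
Hypothesis delta_ge : mu * rho ^+ 2 * (25 * (tau / N)) <= delta.

Let f (e : {ffun 'I_n -> bool}) : 'rV[R]_n -> R :=
  perturb mu rho (@hard R n N tau (rademacher n e)).

Let b : 'rV[R]_n -> R := perturb mu rho (hard_base (N := N)).

Let C (e : {ffun 'I_n -> bool}) : pred 'rV[R]_n :=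
  [pred x | tau * norm2 x < `|dotv x (rademacher n e)|].

Let e0 : 0 < mu * rho ^+ 2. Proof. by rewrite mulr_gt0 ?exprn_gt0. Qed.

Let correlation_scale e x : ~~ C e x ->
  `|dotv (rho^-1 *: x) (rademacher n e)| <= tau * norm2 (rho^-1 *: x).
Proof.
rewrite /C /= -leNgt dotvZl norm2Z normrM mulrCA => h.
by rewrite ler_wpM2l.
Qed.

Let perturbE (h : 'rV[R]_n -> R) x : perturb mu rho h x =
  mu * rho ^+ 2 * (norm2 (rho^-1 *: x) ^+ 2 / 2 + h (rho^-1 *: x)).
Proof.
rewrite /perturb norm2Z gtr0_norm ?invr_gt0 //.
by field; rewrite gt_eqF.
Qed.

(** Boundedness from below, required for [inf] to be a genuine infimum; t^2 / 2 - 3 t >= - 9 / 2. *)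
Let f_lower e x : mu * rho ^+ 2 * - (9 / 2) <= f e x.
Proof.
rewrite /f perturbE ler_pM2l //; set u := rho^-1 *: x.
have := @hard_ge R n N tau (rademacher n e) u.
have := dotv_le (rademacher n e) u; rewrite norm2_rademacher // mul1r.
have := sqr_ge0 (norm2 u - 3); move: (norm2 u) (dotv _ _) (hard _) => t s h.
nra.
Qed.

Let f_at_direction e :
  f e (rho *: rademacher n e) = mu * rho ^+ 2 * - (5 / 2).
Proof.
rewrite /f perturbE scalerA mulVf ?gt_eqF // scale1r norm2_rademacher //.
by rewrite hard_at_direction ?norm2_rademacher //; congr (_ * _); field.
Qed.

(** In units of mu rho^2, an uncorrelated point has value at least t^2 / 2 - 3 tau t >= - 1 / 2
    because tau <= 1 / 3, while rho v has value - 5 / 2: a gap of 2. *)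
Let f_far e x : ball2 r x -> ~~ C e x ->
  mu * rho ^+ 2 < f e x - inf (f e @` ball2 r).
Proof.
move=> xr /correlation_scale xC.
have infle : inf (f e @` ball2 r) <= mu * rho ^+ 2 * - (5 / 2).
  rewrite -(f_at_direction e); apply: ge_inf.
    by exists (mu * rho ^+ 2 * - (9 / 2)) => _ [y _ <-].
  exists (rho *: rademacher n e) => //.
  by rewrite /ball2 /= norm2Z norm2_rademacher // mulr1 gtr0_norm.
have : mu * rho ^+ 2 * - (1 / 2) <= f e x.
  rewrite /f perturbE ler_pM2l //; set u := rho^-1 *: x.
  have := @hard_ge R n N tau (rademacher n e) u.
  move: xC; rewrite -/u dotvC ler_norml => /andP[_].
  have := sqr_ge0 (norm2 u - 1); have := norm2_ge0 u; have := tau1.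
  move: (norm2 u) (dotv _ _) (hard _) => t s h; nra.
have := e0; move: infle; lra.
Qed.

Theorem hard_instance_bound (A : rand_algo R 'rV[R]_n) (T : nat) (beta : R) :
  solves (ball2 r) (SmSC L mu r) (mu * rho ^+ 2) beta delta T A ->
  1 - beta <= T.+1%:R * (2 * expR (- (n%:R * tau ^+ 2 / 8))).
Proof.
have N0 : 0 < N by exact: lt_le_trans N3.
have sel e := perturb_selection (ltW mu0) rho0
  (hard_selection N3 tau0 (v := rademacher n e)).
have lip e : lipschitz_map_on setT L (@perturb_grad R n
    (@hard_grad R n N tau (rademacher n e)) mu rho).
  have := perturb_grad_lipschitz (ltW mu0) rho0 (hard_grad_lipschitz N3 tau0
    (norm2_rademacher n e n0)).
  by move=> h x y Sx Sy; apply: le_trans (h x y Sx Sy) _; rewrite ler_wpM2r.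
apply: (@resisting_bound _ _ _ _ _ f b C).
- apply: le_trans delta_ge; rewrite !mulr_ge0 ?(ltW e0) ?invr_ge0 //;
  exact: ltW.
- by move=> e; apply: (selection_SmSC _ _ _ _ _ (ltW mu0) (sel e) (lip e)).
- by move=> e; apply: (selection_continuous (ltW mu0) (sel e) (lip e)).
- by apply: continuous_perturb; exact: continuous_hard_base.
- move=> e x _ /correlation_scale xC; apply: le_trans delta_ge.
  rewrite /f /b !perturbE -mulrBr normrM gtr0_norm // ler_pM2l //.
  rewrite opprD addrACA subrr add0r.
  by apply: hard_near_base => //; exact: norm2_rademacher.
- by move=> e x; exact: f_far.
- move=> x; rewrite card_ffun card_bool card_ord.
  exact: rademacher_correlated.
- by rewrite card_ffun card_bool expn_gt0.
Qed.

End HardInstance.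

(** * Choice of parameters *)

Lemma powR_natfrac {R : realType} (x : R) (m d : nat) : 0 <= x -> (0 < d)%N ->
  x `^ (m%:R / d%:R) = (x `^ (1 / d%:R)) ^+ m.
Proof.
by move=> x0 d0; rewrite -powR_mulrn ?powR_ge0 // -powRrM div1r mulrC.
Qed.

Lemma powR_root_exp {R : realType} (x : R) (d : nat) : 0 <= x -> (0 < d)%N ->
  (x `^ (1 / d%:R)) ^+ d = x.
Proof.
move=> x0 d0; rewrite -powR_natfrac // divff ?powRr1 // pnatr_eq0.
by rewrite -lt0n.
Qed.

Lemma expRN_mul_ln {R : realType} (x c : R) : 0 < x ->
  expR (- (c * ln x)) = (x `^ c)^-1.
Proof. by move=> x0; rewrite expRN /powR gt_eqF. Qed.

Section NoiseBound.
Context {R : realType} {n T : nat} {D mu rho r beta c C1 : R}.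
Hypothesis n0 : (0 < n)%N.
Hypothesis mu0 : 0 < mu.
Hypothesis rho0 : 0 < rho.
Hypothesis rhor : rho <= r.
Hypothesis D12 : 12 <= D.
Hypothesis c1 : 1 <= c.
Hypothesis C1e : expR 1 <= C1.
Hypothesis C18 : 8 <= C1.
Hypothesis beta12 : beta < 1 / 2.

Let a : R := n%:R `^ (1 / 4).
Let Q : R := a ^+ 3 * D.
Let Lambda : R := c * ln (C1 * Q).

Hypothesis Lambda_le : 8 * Lambda <= n%:R / 9.
Hypothesis T_le : T%:R <= Q `^ c / 16.

Let nR0 : 0 < n%:R :> R. Proof. by rewrite ltr0n. Qed.

Let a4 : a ^+ 4 = n%:R. Proof. exact: powR_root_exp. Qed.

Let a1 : 1 <= a.
Proof.
rewrite -(@ler_pXn2r _ 4) ?nnegrE ?powR_ge0 //.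
by rewrite a4 expr1n ler1n.
Qed.

Let Q1 : 1 <= Q.
Proof.
have a31 : 1 <= a ^+ 3 by exact: exprn_ege1.
by have := D12; rewrite /Q; nra.
Qed.

Let Lambda1 : 1 <= Lambda.
Proof.
have : 1 <= ln (C1 * Q).
  rewrite -(expRK 1) ler_ln ?posrE ?expR_gt0 //; have := C1e; have := Q1.
    have := expR_gt0 (1 : R); nra.
  have := C18; nra.
by have := c1; rewrite /Lambda; nra.
Qed.

Let tau : R := Num.sqrt (8 * Lambda / n%:R).

Let tau_sqr : tau ^+ 2 = 8 * Lambda / n%:R.
Proof.
rewrite sqr_sqrtr // divr_ge0 // mulr_ge0 //.
exact: le_trans ler01 Lambda1.
Qed.

Let tau_gt0 : 0 < tau.
Proof.
by rewrite sqrtr_gt0 divr_gt0 // mulr_gt0 //; have := Lambda1; lra.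
Qed.

Let tau_le : tau <= 1 / 3.
Proof.
rewrite -(@ler_pXn2r _ 2) ?nnegrE ?(ltW tau_gt0) ?divr_ge0 // tau_sqr.
by rewrite ler_pdivrMr //; have := Lambda_le; lra.
Qed.

Let N : R := Num.min (D / 3) tau^-1.

Let N3 : 3 <= N.
Proof.
rewrite le_min; apply/andP; split; first by have := D12; lra.
by rewrite -[3]invrK lef_pV2 ?posrE ?invr_gt0 //; have := tau_le; lra.
Qed.

Let N0 : 0 < N. Proof. exact: lt_le_trans N3. Qed.

Let Ntau : N * tau <= 1.
Proof. by rewrite -ler_pdivlMr // div1r ge_min lexx orbT. Qed.

Let N_sqr : 5 * N ^+ 2 <= D ^+ 2.
Proof.
have : N <= D / 3 by rewrite ge_min lexx.
have := N0; move: (N) => m; nra.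
Qed.

Let level : R := Num.max (1 / (a * D)) (n%:R^-1) * (13 * C1 * Lambda) ^+ 2.

Let base_gap_le : 25 * (tau / N) <= level.
Proof.
have a0 : 0 < a by exact: lt_le_trans a1.
have D0 : 0 < D by exact: lt_le_trans D12.
have L0 : 0 < Lambda by exact: lt_le_trans Lambda1.
(* When N = D / 3, the gap needs 25 * 3 * 3 = 225; when N = 1 / tau, it needs 25 * 8 = 200. *)
have big : 225 * Lambda <= (13 * C1 * Lambda) ^+ 2.
  have h : 104 * Lambda <= 13 * C1 * Lambda.
    by rewrite ler_pM2r //; have := C18; lra.
  apply: (@le_trans _ _ ((104 * Lambda) ^+ 2)).
    by have := Lambda1; nra.
  have l0 : 0 <= 104 * Lambda by rewrite mulr_ge0 // ltW.
  by rewrite ler_pXn2r ?nnegrE // (le_trans l0).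
rewrite /level; have [DN|DN] := leP (D / 3) tau^-1.
  have -> : N = D / 3 by apply/min_idPl.
  (* Since n = a^4, it suffices that 8 Lambda <= 9 Lambda^2 and a^2 <= a^4. *)
  have ta : tau <= 3 * Lambda / a.
    rewrite -(@ler_pXn2r _ 2) ?nnegrE ?(ltW tau_gt0) //; last first.
      by rewrite ltW // divr_gt0 // mulr_gt0.
    rewrite tau_sqr expr_div_n ler_pdivrMr // mulrAC ler_pdivlMr ?exprn_gt0 //.
    have := a4; have := a1; have := Lambda1; move=> l1 a1' <-.
    have a21 : 1 <= a ^+ 2 by exact: exprn_ege1.
    have -> : a ^+ 4 = a ^+ 2 * a ^+ 2 by rewrite -exprD.
    have h1 : 8 * Lambda <= (3 * Lambda) ^+ 2 by nra.
    have h2 : a ^+ 2 <= a ^+ 2 * a ^+ 2 by rewrite ler_peMl // ltW // exprn_gt0.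
    have l0 : 0 <= 8 * Lambda by rewrite mulr_ge0 // ltW.
    exact: ler_pM l0 (sqr_ge0 a) h1 h2.
  apply: (@le_trans _ _ (1 / (a * D) * (13 * C1 * Lambda) ^+ 2)); last first.
    by rewrite ler_wpM2r ?sqr_ge0 // le_max lexx.
  apply: (@le_trans _ _ (1 / (a * D) * (225 * Lambda))); last first.
    by rewrite ler_pM2l // divr_gt0 // mulr_gt0.
  have -> : 1 / (a * D) * (225 * Lambda) = 25 * (3 * Lambda / a / (D / 3)).
    by field; rewrite !gt_eqF.
  by rewrite ler_pM2l // ler_pM2r // invr_gt0 divr_gt0.
have -> : N = tau^-1 by apply/min_idPr; exact: ltW.
apply: (@le_trans _ _ (n%:R^-1 * (13 * C1 * Lambda) ^+ 2)); last first.
  by rewrite ler_wpM2r ?sqr_ge0 // le_max lexx orbT.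
rewrite invrK -expr2 tau_sqr mulrCA mulrA [leRHS]mulrC ler_pM2r ?invr_gt0 //.
by have := big; lra.
Qed.

(** The exponential is 1 / (C1 Q)^c with C1^c >= 8, and T + 1 <= (17 / 16) Q^c, so the product is at
    most 17 / 64. *)
Let failure : T.+1%:R * (2 * expR (- (n%:R * tau ^+ 2 / 8))) < 1 / 2 :> R.
Proof.
have -> : n%:R * tau ^+ 2 / 8 = Lambda.
  by rewrite tau_sqr; field; rewrite gt_eqF.
have Q0 : 0 < Q by exact: lt_le_trans Q1.
have C0 : 0 < C1 by exact: lt_le_trans C18.
have Qc : 1 <= Q `^ c by exact: le_trans Q1 (le1r_powR Q1 c1).
have C1c : 8 <= C1 `^ c.
  apply: le_trans C18 (le1r_powR _ c1); by apply: le_trans C18; rewrite ler1n.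
rewrite /Lambda (expRN_mul_ln _ c (mulr_gt0 C0 Q0)).
rewrite (powRM _ (ltW C0) (ltW Q0)).
have T1 : T.+1%:R <= 17 / 16 * Q `^ c :> R.
  by rewrite -natr1; have := T_le; lra.
rewrite mulrA ltr_pdivrMr ?mulr_gt0 ?powR_gt0 //.
move: T1 Qc C1c; move: (Q `^ c) (C1 `^ c) (T.+1%:R : R) => q s t; nra.
Qed.

Lemma max_noise_normalized_le (L : R) : mu * (1 + D ^+ 2) <= L ->
  (max_noise (@ball2 R n r) (SmSC L mu r) (mu * rho ^+ 2) beta T <=
   (mu * rho ^+ 2 *
    (Num.max (1 / (a * D)) (n%:R^-1) * (13 * C1 * Lambda) ^+ 2))%:E)%E.
Proof.
move=> DL; apply: ge_ereal_sup => _ [delta [delta0 [A solA]] <-];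
  rewrite lee_fin.
rewrite leNgt; apply/negP => lt_delta.
have NL : mu * (1 + 5 * N ^+ 2) <= L.
  by apply: le_trans DL; rewrite ler_pM2l // lerD2l; exact: N_sqr.
have gap : mu * rho ^+ 2 * (25 * (tau / N)) <= delta.
  apply: le_trans (ltW lt_delta); rewrite ler_pM2l ?mulr_gt0 ?exprn_gt0 //.
have := hard_instance_bound n0 mu0 rho0 rhor N3 (ltW tau_gt0) tau_le Ntau NL gap
  _ _ _ solA.
have := failure; have := beta12; lra.
Qed.

End NoiseBound.

(** * Translation into normalized parameters *)

Section ParameterChange.
Context {R : realType} {n : nat} {L mu eps : R}.
Hypothesis n0 : (0 < n)%N.
Hypothesis mu0 : 0 < mu.
Hypothesis muL : mu < L.
Hypothesis eps0 : 0 < eps.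

Let D : R := Num.sqrt ((L - mu) / mu).
Let rho : R := Num.sqrt (eps / mu).
Let a : R := n%:R `^ (1 / 4).

Lemma condition_sqrt_gt0 : 0 < D.
Proof. by rewrite sqrtr_gt0 divr_gt0 // subr_gt0. Qed.

Lemma scale_gt0 : 0 < rho.
Proof. by rewrite sqrtr_gt0 divr_gt0. Qed.

Lemma scale_eps : mu * rho ^+ 2 = eps.
Proof. by rewrite sqr_sqrtr ?divr_ge0 ?(ltW eps0) ?(ltW mu0) // mulrC divfK
  ?gt_eqF. Qed.

Lemma condition_mu : mu * D ^+ 2 = L - mu.
Proof.
by rewrite sqr_sqrtr ?divr_ge0 ?subr_ge0 ?(ltW muL) ?(ltW mu0) // mulrC divfK
  ?gt_eqF.
Qed.

Lemma M0_normalized (Csm : R) :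
  M0 Csm L mu eps n = mu * D * rho / (4 * Num.sqrt Csm * a).
Proof.
have -> : M0 Csm L mu eps n =
    1 / (4 * Num.sqrt Csm) * (Num.sqrt ((L - mu) * eps) / a) by [].
rewrite -condition_mu -scale_eps.
have -> : mu * D ^+ 2 * (mu * rho ^+ 2) = (mu * D * rho) ^+ 2 by ring.
rewrite sqrtr_sqr gtr0_norm; last first.
  by rewrite !mulr_gt0 ?condition_sqrt_gt0 ?scale_gt0.
by rewrite div1r mulrCA -invfM.
Qed.

Lemma noise_level_normalized :
  Num.max (Num.sqrt mu * eps / (a * Num.sqrt (L - mu))) (eps / n%:R) =
  eps * Num.max (1 / (a * D)) (n%:R^-1).
Proof.
rewrite maxr_pMr ?ltW //; congr (Num.max _ _).
rewrite /D sqrtrM ?subr_ge0 ?ltW // sqrtrV ?ltW //.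
have a0 : a != 0 by rewrite gt_eqF // powR_gt0 // ltr0n.
by field; rewrite a0 !gt_eqF // sqrtr_gt0 ?subr_gt0.
Qed.

(** Keeping only the 1 / n branch of the maximum in [regA] turns smallness into a bound of the
    squared logarithm by n. *)
Lemma regA_log_sqr_le (Csm Clog c creg : R) : creg <= 1 ->
  regA Clog (4 * c + 8) (M0 Csm L mu eps n) mu (2 * eps) n <= creg ->
  (13 * (4 * c + 8) *
    ln (Clog / (4 * Num.sqrt 2 * Num.sqrt Csm) * (a ^+ 3 * D))) ^+ 2 <= n%:R.
Proof.
move=> creg1; rewrite /regA.
have -> : Clog * n%:R * M0 Csm L mu eps n / Num.sqrt (mu * (2 * eps)) =
    Clog / (4 * Num.sqrt 2 * Num.sqrt Csm) * (a ^+ 3 * D).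
  rewrite M0_normalized -[in mu * (2 * eps)]scale_eps.
  have -> : mu * (2 * (mu * rho ^+ 2)) = 2 * (mu * rho) ^+ 2 by ring.
  have mr0 : 0 < mu * rho by rewrite mulr_gt0 // scale_gt0.
  rewrite sqrtrM // sqrtr_sqr gtr0_norm //.
  have a4 : n%:R = a ^+ 4 :> R by rewrite powR_root_exp.
  have a0 : 0 < a by rewrite powR_gt0 // ltr0n.
  have s2 : 0 < Num.sqrt 2 :> R by rewrite sqrtr_gt0.
  have r0 := scale_gt0.
  (* If the root vanishes, both sides are 0 because the inverse of 0 is 0. *)
  rewrite a4; have [C0|C0] := eqVneq (Num.sqrt Csm) 0.
    by rewrite C0 !mulr0 !mul0r !invr0 !mulr0 !mul0r.
  by field; rewrite C0 !gt_eqF.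
set X := (13 * _ * _) ^+ 2 => h.
have X0 : 0 <= X by exact: sqr_ge0.
have : X * n%:R^-1 <= 1.
  apply: le_trans creg1; apply: le_trans h; rewrite ler_wpM2l //.
  by rewrite le_max lexx orbT.
by rewrite ler_pdivrMr ?ltr0n // mul1r.
Qed.

End ParameterChange.

(** * The bound along a sequence of parameters *)

Theorem mainTheorem4 (R : realType) (Csm : R) (hCsm : compact_smoothing Csm) :
  exists Cbar cbar : R, 2 <= Cbar /\ 0 < cbar /\
  forall Clog creg : R, Cbar <= Clog -> 0 < creg -> creg <= cbar ->
  forall c : R, 1 <= c ->
  exists C0 C1 c0 n0 : R, 0 < C0 /\ 0 < C1 /\ 0 < c0 /\ 0 < n0 /\
  forall beta : R, 0 < beta -> beta < 1 / 2 ->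
  forall (n : nat -> nat) (L mu r eps : nat -> R) (T : nat -> nat),
    n k @[k --> \oo] --> \oo ->
    (forall k, n0 <= (n k)%:R) ->
    (forall k, 0 < r k) ->
    (forall k, 0 < mu k /\ mu k < L k) ->
    (forall k, C1 * mu k * r k <= M0 Csm (L k) (mu k) (eps k) (n k)) ->
    (forall k, 0 < eps k /\ eps k < c0 * mu k * r k ^+ 2) ->
    (forall k, regA Clog (4 * c + 8) (M0 Csm (L k) (mu k) (eps k) (n k))
                 (mu k) (2 * eps k) (n k) <= creg) ->
    (T k)%:R / (((n k)%:R `^ (3 / 4) *
                 Num.sqrt ((L k - mu k) / mu k)) `^ c) @[k --> \oo] --> 0 ->
    \forall k \near \oo,
      (max_noise (@ball2 R (n k) (r k)) (@SmSC R (n k) (L k) (mu k) (r k))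
         (eps k) beta (T k)
       <= (C0 *
           Num.max (Num.sqrt (mu k) * eps k /
                      ((n k)%:R `^ (1 / 4) * Num.sqrt (L k - mu k)))
                   (eps k / (n k)%:R) *
           (13 * C1 * c *
            ln (C1 * (n k)%:R `^ (3 / 4) *
                Num.sqrt ((L k - mu k) / mu k))) ^+ 2)%:E)%E.
Proof.
exists 2, 1; split=> //; split=> // Clog creg hClog _ hcreg c c1.
(* The three summands serve [Lambda1] (logarithm at least 1), [failure], and D >= 12,
   respectively. *)
set C1 := expR 1 + 8 + 3 / Num.sqrt Csm.
have e1 : 0 < expR (1 : R) by exact: expR_gt0.
have s0 : 0 <= 3 / Num.sqrt Csm by rewrite divr_ge0 // sqrtr_ge0.
have C1e : expR 1 <= C1 by rewrite /C1; lra.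
have C18 : 8 <= C1 by rewrite /C1; lra.
have C10 : 0 < C1 by exact: lt_le_trans C18.
(* [X] below is the argument of the logarithm in [regA] and
   [C1 * Q = K * X], so [regA] bounds [ln (C1 * Q)] up to [ln K]. *)
set K := C1 * (4 * Num.sqrt 2 * Num.sqrt Csm) / Clog.
(* The term 144 c |ln K| makes 8 c ln K <= n / 18, and 100 serves the quadratic contradiction in
   [cX]. *)
exists 1, C1, 1, (100 + 144 * (c * `|ln K|)).
have cK0 : 0 <= c * `|ln K| by rewrite mulr_ge0 // (le_trans ler01).
do 4 (split; first by [|lra]).
move=> beta _ beta12 n L mu r eps T _ hn hr hmu hM hE hreg hT.
near=> k.
have [mu0 muL] := hmu k; have [eps0 epsr] := hE k; have r0 := hr k.
have nk : 100 + 144 * (c * `|ln K|) <= (n k)%:R := hn k.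
have n0 : (0 < n k)%N by rewrite -(ltr0n R); lra.
set D := Num.sqrt ((L k - mu k) / mu k).
set rho := Num.sqrt (eps k / mu k).
set a := (n k)%:R `^ (1 / 4).
have D0 : 0 < D := condition_sqrt_gt0 mu0 muL.
have rho0 : 0 < rho := scale_gt0 mu0 eps0.
have a4 : a ^+ 4 = (n k)%:R by exact: powR_root_exp.
have a0 : 0 < a by rewrite powR_gt0 // ltr0n.
have a1 : 1 <= a.
  by rewrite -(@ler_pXn2r _ 4) ?nnegrE ?(ltW a0) // a4 expr1n ler1n.
have a3 : (n k)%:R `^ (3 / 4) = a ^+ 3 by exact: powR_natfrac.
have rhor : rho <= r k.
  rewrite -(@ler_pXn2r _ 2) ?nnegrE ?(ltW rho0) ?(ltW r0) //.
  rewrite -(ler_pM2l mu0) (scale_eps mu0 eps0).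
  by move: epsr; rewrite mul1r => /ltW.
have hMk := hM k; rewrite (M0_normalized mu0 muL eps0) -/D -/rho -/a in hMk.
(* Were the root 0, [M0] would be 0 by the convention on inverses, against M0 >= C1 mu r > 0. *)
have Csm0 : 0 < Num.sqrt Csm.
  rewrite lt_def sqrtr_ge0 andbT; apply/eqP => s00.
  by move: hMk; rewrite s00 mulr0 mul0r invr0 mulr0 leNgt !mulr_gt0.
(* The lower bound on [M0] reads D rho >= 4 C1 sqrt (Csm) a r, where C1 sqrt (Csm) >= 3, a >= 1 and
   r >= rho. *)
have D12 : 12 <= D.
  have : C1 * r k * (4 * Num.sqrt Csm * a) <= D * rho.
    rewrite -(ler_pM2l mu0); move: hMk; rewrite ler_pdivlMr ?mulr_gt0 //; lra.
  have h3 : 3 <= C1 * Num.sqrt Csm.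
    by rewrite -ler_pdivrMr // /C1; lra.
  have h4 : 3 * rho <= C1 * Num.sqrt Csm * (r k * a).
    apply: ler_pM => //; first exact: ltW.
    by rewrite -[leLHS]mulr1 ler_pM // ltW.
  move=> h5; rewrite -(ler_pM2r rho0); lra.
set Q := a ^+ 3 * D.
have Q0 : 0 < Q by rewrite mulr_gt0 ?exprn_gt0.
have Q1 : 1 <= Q.
  have : 1 <= a ^+ 3 by exact: exprn_ege1.
  rewrite /Q; nra.
have Clog0 : 0 < Clog by exact: lt_le_trans hClog.
have s2 : 0 < Num.sqrt 2 :> R by rewrite sqrtr_gt0.
set X := Clog / (4 * Num.sqrt 2 * Num.sqrt Csm) * Q.
have X0 : 0 < X by rewrite mulr_gt0 // divr_gt0 // !mulr_gt0.
have K0 : 0 < K by rewrite divr_gt0 // !mulr_gt0.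
have KX : C1 * Q = K * X by rewrite /K /X; field; rewrite !gt_eqF.
have lnX : (13 * (4 * c + 8) * ln X) ^+ 2 <= (n k)%:R.
  exact: (regA_log_sqr_le n0 mu0 muL eps0 _ _ _ _ hcreg (hreg k)).
(* Otherwise 13 (4 c + 8) ln X >= 52 c ln X > 52 n / 144 > n / 3, whose square exceeds n for n >=
   100, against [lnX]. *)
have cX : 8 * (c * ln X) <= (n k)%:R / 18.
  rewrite leNgt; apply/negP => lt_cX.
  have y0 : 0 < (n k)%:R / 3 :> R by rewrite divr_gt0 // ltr0n.
  have y1 : (n k)%:R / 3 <= 13 * (4 * c + 8) * ln X.
    have lX : 0 < ln X by rewrite -(pmulr_rgt0 _ (lt_le_trans ltr01 c1)); lra.
    nra.
  have : ((n k)%:R / 3) ^+ 2 <= (n k)%:R :> R.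
    apply: le_trans lnX; rewrite ler_pXn2r ?nnegrE ?(ltW y0) //.
    exact: le_trans (ltW y0) y1.
  have : 100 <= (n k)%:R :> R by lra.
  nra.
have cK : 8 * (c * ln K) <= (n k)%:R / 18.
  have : c * ln K <= c * `|ln K| by rewrite ler_wpM2l ?ler_norm // (le_trans
    ler01).
  lra.
have Lambda_le : 8 * (c * ln (C1 * Q)) <= (n k)%:R / 9.
  rewrite KX lnM ?posrE //; lra.
have T_le : (T k)%:R <= Q `^ c / 16.
  have : `|0 - (T k)%:R / Q `^ c| <= 1 / 16.
    rewrite /Q -a3 /D; near: k.
    by apply: (cvgr_dist_le _ _ hT); rewrite divr_gt0.
  rewrite sub0r normrN ger0_norm ?divr_ge0 ?powR_ge0 //.
  by rewrite ler_pdivrMr ?powR_gt0 // mulrC mulrA mulr1.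
have := max_noise_normalized_le n0 mu0 rho0 rhor D12 c1 C1e C18 beta12
  Lambda_le T_le (L k).
rewrite (scale_eps mu0 eps0) (noise_level_normalized n0 mu0 muL eps0).
rewrite -/D -/a a3.
have -> : 13 * C1 * (c * ln (C1 * (a ^+ 3 * D))) = 13 * C1 * c * ln (C1 * a ^+
  3 * D).
  by rewrite !mulrA.
rewrite (mulrA (eps k)) !mul1r; apply.
by rewrite mulrDr mulr1 (condition_mu mu0 muL) subrKC.
Unshelve. all: by end_near. Qed.
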